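(* Let $1\le\alpha<2$ and $\beta\ge1$ such that $\alpha>1$ or $\beta>1$, and for $t>0$ let $u_t$ be a minimizer of $E_t^{\alpha,\beta}(\cdot;f)$ and $R(t)=\|Au_t-f\|_{\mathcal H}$. The forward solution path $t\mapsto Au_t$ is Lipschitz continuous on $(\delta,\infty)$ for all $\delta>0$. Furthermore, $(Au_t)'$ exists almost everywhere in $(\delta,\infty)$, and if $1<\alpha<2$ and $\beta=1$ it holds for almost all $t\in(0,\infty)$ $$\|(Au_t)'\|_{\mathcal H}\le\frac1{\alpha-1}\frac{R(t)}{t}\le\frac1{\alpha-1}\frac{\|f\|_{\mathcal H}}{t}.$$ In that case ($1<\alpha<2$, $\beta=1$), if (RC) holds, this can be improved to $$\|(Au_t)'\|_{\mathcal H}\le\frac1{\alpha-1}C_R\,t^{\frac{1-\alpha}{\alpha}}\quad\text{for a.e. }t\in(0,\infty),\qquad C_R:=J_{\min}^{\beta/\alpha},$$ and if also (SC) holds, to $$\|(Au_t)'\|_{\mathcal H}\le\frac1{\alpha-1}C_S\,t^{\frac{2-\alpha}{\alpha-1}}\quad\text{for a.e. }t\in(0,\infty),\qquad C_S:=s_*^{\frac1{\alpha-1}}J_{\min}^{\frac{\beta-1}{\alpha-1}}.$$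
   Context: Setting: $\mathcal X$ is the (real) Banach space dual of a separable Banach space $\mathcal Y$; $\mathcal H$ is a real Hilbert space; $A:\mathcal X\to\mathcal H$ is bounded and linear, with adjoint $A^*:\mathcal H\to\mathcal X^*$, $\langle A^*q,u\rangle=\langle q,Au\rangle$. $J:\mathcal X\to[0,\infty]$ is convex, proper, weak$^*$ lower semi-continuous and absolutely one-homogeneous ($J(cu)=|c|J(u)$). $\mathcal N(J)=\{u:J(u)=0\}$, $\mathrm{dom}(J)=\{u:J(u)<\infty\}$, and $\partial J(u)=\{p\in\mathcal X^*: J(u)+\langle p,v-u\rangle\le J(v)\ \forall v\in\mathcal X\}$. The datum $f\in\mathcal H$ is such that any $u\in\mathcal X$ with $Au=f$ satisfies $J(u)\ne 0$. For $\alpha,\beta\ge1$, $t>0$: $E_t^{\alpha,\beta}(u;f)=\frac1\alpha\|Au-f\|_{\mathcal H}^\alpha+\frac t\beta J(u)^\beta$ for $u\in\mathcal X$. If $\alpha>1$ or $\beta>1$, the element $Au_t$ does not depend on the choice of minimizer $u_t$ of $E_t^{\alpha,\beta}(\cdot;f)$. Standing assumptions: (1) $u\mapsto\|Au\|_{\mathcal H}$ is a norm on $\mathcal N(J)$ equivalent to the restriction of $\|\cdot\|_{\mathcal X}$. (2) There is $C>0$ with $\|u-\mathcal P^A(Au)\|_{\mathcal X}\le C J(u)$ for all $u\in\mathcal X$, where $\mathcal P^A(g)$ denotes the (unique) minimizer of $\|Au-g\|_{\mathcal H}$ over $u\in\mathcal N(J)$, $g\in\mathcal H$. (3) $A$ is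 weak$^*$-to-weak continuous: $u_k\rightharpoonup^* u$ in $\mathcal X$ implies $Au_k\rightharpoonup Au$ in $\mathcal H$. (RC): there exists $u^\dagger\in\mathrm{dom}(J)$ with $Au^\dagger=f$. (SC): such a $u^\dagger$ exists for which additionally $A^*q\in\partial J(u^\dagger)$ for some $q\in\mathcal H$. $J_{\min}:=\min\{J(u):u\in\mathcal X,\ Au=f\}$ (under (RC)); $s_*:=\inf\{\|q\|_{\mathcal H}: q\in\mathcal H,\ A^*q\in\partial J(u)\text{ for some }u\in\mathrm{dom}(J)\text{ with }Au=f\}$ (under (RC) and (SC)). *)

(* Defs.v *)
From mathcomp Require Import all_boot all_order all_algebra.
From mathcomp Require Import all_classical all_reals all_analysis.
Import Order.TTheory GRing.Theory Num.Theory numFieldNormedType.Exports.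

Set Implicit Arguments.
Unset Strict Implicit.
Unset Printing Implicit Defensive.

Local Open Scope classical_set_scope.
Local Open Scope ring_scope.

Definition separable (T : topologicalType) : Prop :=
  exists2 D : set T, countable D & dense D.

(* [b] identifies [X] isometrically with the space of continuous linear
   functionals on [Y], with the operator norm. *)
Definition is_dual_of (R : realType) (X Y : completeNormedModType R)
    (b : {bilinear X -> Y -> R | *%R & *%R}) : Prop :=
  [/\ forall x : X, continuous (b x : Y -> R),
      forall x : X, `|x| = sup [set `|b x y| | y in [set y : Y | `|y| <= 1]]
    & forall phi : Y -> R, scalar phi -> continuous phi ->
        exists x : X, forall y : Y, b x y = phi y].

(* [H] is a Hilbert space: its complete norm is induced by [dot]. *)
Definition induces_norm (R : realType) (H : completeNormedModType R)
    (dot : {dot H for @idfun R}) : Prop :=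
  forall x : H, dot x x = `|x| ^+ 2.

Section Dual.
Variables (R : realType) (X Y : completeNormedModType R).
Variable b : {bilinear X -> Y -> R | *%R & *%R}.

(* [X] with the topology of pointwise convergence on [Y] *)
Definition weak_star : topologicalType :=
  initial_topology ((fun x : X => b x) : X -> {ptws Y -> R}).

Definition weak_star_lsc (J : X -> \bar R) : Prop :=
  lower_semicontinuous (J : weak_star -> \bar R).

Definition weak_star_cvg (v : nat -> X) (x : X) : Prop :=
  (v : nat -> weak_star) n @[n --> \oo] --> (x : weak_star).

End Dual.

Definition weak_cvg (R : realType) (H : completeNormedModType R)
    (dot : {dot H for @idfun R}) (v : nat -> H) (x : H) : Prop :=
  forall q : H, dot q (v n) @[n --> \oo] --> dot q x.

Section Functional.
Variables (R : realType) (X : completeNormedModType R) (J : X -> \bar R).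
Local Open Scope ereal_scope.

Definition proper_functional : Prop := exists u : X, J u < +oo.

Definition convex_functional : Prop :=
  forall (l : R) (u v : X), (0 <= l <= 1)%R ->
    J (l *: u + (1 - l) *: v)%R <= l%:E * J u + (1 - l)%:E * J v.

(* For [c = 0] this gives [J 0 = 0], since [0 * +oo = 0]. *)
Definition absolutely_one_homogeneous : Prop :=
  forall (c : R) (u : X), J (c *: u)%R = `|c|%:E * J u.

Definition null_set : set X := [set u | J u = 0].

Definition dom : set X := [set u | J u < +oo].

(* Elements of the topological dual of [X] are represented as functions. *)
Definition subdiff (u : X) : set (X -> R) :=
  [set p : X -> R | [/\ scalar p, continuous p
             & forall v : X, J u + (p (v - u)%R)%:E <= J v]].

End Functional.

Section Problem.
Variables (R : realType) (X H : completeNormedModType R).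
Variables (dot : {dot H for @idfun R}) (A : {linear X -> H}).
Variables (J : X -> \bar R) (f : H).

Definition adjoint (q : H) : X -> R := fun u => dot q (A u).

Definition bounded_operator : Prop :=
  exists M : R, forall u : X, `|A u| <= M * `|u|.

Definition energy (alpha beta t : R) (u : X) : \bar R :=
  ((alpha^-1 * `|A u - f| `^ alpha)%:E + (t / beta)%:E * (J u `^ beta))%E.

Definition is_minimizer (F : X -> \bar R) (u : X) : Prop :=
  forall v : X, (F u <= F v)%E.

Definition norm_equiv_on_null_set : Prop :=
  exists c C : R, [/\ 0 < c, 0 < C &
    forall u, null_set J u -> c * `|u| <= `|A u| <= C * `|u|].

Definition is_null_proj (g : H) (u : X) : Prop :=
  null_set J u /\ forall v, null_set J v -> `|A u - g| <= `|A v - g|.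

(* Under [norm_equiv_on_null_set] the minimizer exists and is unique; the
   default value 0 is then never used. *)
Definition null_proj (g : H) : X := xget 0 [set u | is_null_proj g u].

Definition poincare_inequality : Prop :=
  exists2 C : R, 0 < C &
    forall u : X, (`|u - null_proj (A u)|%:E <= C%:E * J u)%E.

Definition range_condition : Prop := exists2 u, dom J u & A u = f.

Definition source_condition : Prop :=
  exists u : X, [/\ dom J u, A u = f & exists q : H, subdiff J u (adjoint q)].

(* Under [range_condition] and the standing assumptions the infimum is finite
   and attained, so this is the minimum. *)
Definition Jmin : R := fine (ereal_inf [set J u | u in [set u | A u = f]]).

Definition sstar : R :=
  inf [set `|q| | q in [set q : H |
    exists u : X, [/\ dom J u, A u = f & subdiff J u (adjoint q)]]].

Definition C_R (alpha beta : R) : R := Jmin `^ (beta / alpha).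

Definition C_S (alpha beta : R) : R :=
  sstar `^ (alpha - 1)^-1 * Jmin `^ ((beta - 1) / (alpha - 1)).

End Problem.

(* Main.v *)
Require Import Defs.
From mathcomp Require Import all_boot all_order all_algebra.
From mathcomp Require Import all_classical all_reals all_analysis.
From mathcomp Require Import measurable_realfun ring lra.
Import Order.TTheory GRing.Theory Num.Theory numFieldNormedType.Exports.

(** Write [w t = A (u t) - f], [r t = |w t|] and [F w = |w|^alpha / alpha].

    Comparing the energy of [u t] with the energy on the segment from [u t] to
    [u s], at a point tending to [u t], gives ([minimizer_gap])
      [F (w t) - F (w s) + K <= t/beta * (J (u s)^beta - J (u t)^beta)],
    where [K] measures how convex [F] is between [w t] and [w s].  Weighting
    this inequality by [s], its mirror image by [t], and adding, makes [J]
    disappear.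

    If [1 < alpha < 2], the Hessian of [F] is at least
    [(alpha - 1) * M^(alpha - 2)] on the ball of radius [M], so
    [K = (alpha - 1)/2 * M^(alpha - 2) * |w t - w s|^2] is admissible as soon as
    [M] bounds both residuals, and
      [|w t - w s| * (alpha - 1) * (t + s) <= 2 * M * |t - s|]
    ([path_increment_le]).  As residuals never exceed [|f|], the path is
    Lipschitz away from [0]; letting [s] tend to [t], so that [M] may tend to
    [r t], bounds the derivative by [r t / ((alpha - 1) * t)]
    ([path_derivative_le]).

    If [alpha = 1], the norm is affine along rays and [K] only controls the
    angle between [w t] and [w s].  The difference of the residuals is governed
    by [J^beta] instead, which is Lipschitz along the path because [beta > 1]
    ([functional_powB_le], [path_increment_le_norm]).

    For [beta = 1] the same segment test against an exact solution [v],
    [A v = f], gives [r^alpha <= t * (J v - J (u t))] ([residual_pow_le]); this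
    is at most [t * Jmin], and at most [t * |q| * r] if [A^* q] is a subgradient
    at [v].  Inserted in the bound [r / ((alpha - 1) * t)], these estimates of
    [r] are the two improvements.

    Almost everywhere differentiability of Lipschitz maps into a Hilbert space
    ([lipschitz_ae_derivable]) is obtained without vector integration.  The
    Riesz sums [sum |g b - g a|^2 / (b - a)] over finite chains of points
    increase under refinement, and by Pythagoras subtracting from [g], on an
    interval, the affine map with the mean slope of [g] decreases its Riesz
    variation by exactly the quotient of that interval.  Hence for a chain whose
    sum is nearly maximal, [g] minus its piecewise affine interpolant has small
    variation.  A Vitali covering argument for monotone functions then shows
    that the difference quotients of this remainder are small outside a set of
    small measure.  So almost everywhere the difference quotients of [g] are
    within any [e] of a fixed vector near the point, that is, they are
    Cauchy. *)

Set Implicit Arguments.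
Unset Strict Implicit.
Unset Printing Implicit Defensive.

Local Open Scope classical_set_scope.
Local Open Scope ring_scope.

(** * Real powers *)

Section powers.
Variable R : realType.
Implicit Types a x y z l : R.

(** The graph of a convex power lies above its tangents; Young's inequality for
    [y] and [x^(a-1)] is exactly this. *)
Lemma powR_tangent a x y : 1 <= a -> 0 <= x -> 0 <= y ->
  x `^ a - y `^ a <= a * (x `^ (a - 1) * (x - y)).
Proof.
rewrite le_eqVlt => /predU1P[<-|a1] x0 y0.
  by rewrite subrr powRr0 !powRr1// !mul1r.
have a0 : 0 < a by lra.
have b0 : 0 < a - 1 by lra.
have := @conjugate_powR R y (x `^ (a - 1)) a (a / (a - 1)) y0 (powR_ge0 _ _) a0.
rewrite divr_gt0// => /(_ isT); rewrite -powRrM.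
rewrite (_ : (a - 1) * (a / (a - 1)) = a); last by field; rewrite gt_eqF.
have -> : a^-1 + (a / (a - 1))^-1 = 1 by field; rewrite !gt_eqF.
move=> /(_ erefl) Y.
rewrite mulrBr (mulrC _ x) mulr_powRB1//.
have : a * (y * x `^ (a - 1)) <= y `^ a + (a - 1) * x `^ a.
  have -> : y `^ a + (a - 1) * x `^ a = a * (y `^ a / a + x `^ a / (a / (a - 1))).
    by field; rewrite !gt_eqF.
  by rewrite ler_pM2l.
lra.
Qed.

Lemma powR_convex a l x y : 1 <= a -> 0 <= l <= 1 -> 0 <= x -> 0 <= y ->
  ((1 - l) * x + l * y) `^ a <= (1 - l) * x `^ a + l * y `^ a.
Proof.
move=> a1 /andP[l0 l1] x0 y0; set z := _ + _.
have z0 : 0 <= z by rewrite addr_ge0// mulr_ge0// subr_ge0.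
have := powR_tangent a1 z0 x0; have := powR_tangent a1 z0 y0.
set c := z `^ (a - 1) => hy hx.
have : (1 - l) * (z `^ a - x `^ a) + l * (z `^ a - y `^ a) <=
       (1 - l) * (a * (c * (z - x))) + l * (a * (c * (z - y))).
  by apply: lerD; apply: ler_wpM2l => //; rewrite subr_ge0.
have -> : (1 - l) * (a * (c * (z - x))) + l * (a * (c * (z - y))) = 0.
  by rewrite /z; ring.
lra.
Qed.

(** A lower bound for the increments of a concave power on [0, 1]: there the
    derivative [a * z^(a-1)] is at least [a]. *)
Lemma ler_powRB a x y : 0 < a < 1 -> 0 < x <= y -> y <= 1 ->
  a * (y - x) <= y `^ a - x `^ a.
Proof.
move=> /andP[a0 a1] /andP[x0 xy] y1.
have y0 : 0 < y by apply: lt_le_trans xy.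
have c0 : 0 < x / y by rewrite divr_gt0.
have c1 : x / y <= 1 by rewrite ler_pdivrMr// mul1r.
(* Bernoulli's inequality for the exponent [a < 1], read off the tangent at [1]
   of the inverse power *)
have E : (x / y) `^ a - 1 <= a * (x / y - 1).
  have := @powR_tangent a^-1 1 ((x / y) `^ a).
  rewrite invf_ge1// (ltW a1) => /(_ isT ler01 (powR_ge0 _ _)).
  rewrite !powR1/= -powRrM mulfV ?gt_eqF// powRr1 ?(ltW c0)// mul1r ler_pdivlMl//.
  lra.
have -> : x `^ a = y `^ a * (x / y) `^ a.
  by rewrite -powRM ?(ltW y0) ?(ltW c0)// mulrCA mulfV ?gt_eqF// mulr1.
have ya : y <= y `^ a by apply: ger1_powR; rewrite ?y0// ltW.
have : y * (a * (1 - x / y)) <= y `^ a * (a * (1 - x / y)).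
  by apply: ler_wpM2r => //; rewrite mulr_ge0 ?(ltW a0)// subr_ge0.
have -> : y * (a * (1 - x / y)) = a * (y - x) by field; rewrite gt_eqF.
have : y `^ a * ((x / y) `^ a - 1) <= y `^ a * (a * (x / y - 1)).
  by rewrite ler_wpM2l// powR_ge0.
lra.
Qed.

(** The second order Taylor bound: on [0, 1] the second derivative
    [(a - 1) * x^(a-2)] of [x^a / a] is at least [a - 1].  As it blows up at
    [0], the cases [x = 0] and [z = 0] are done by hand and the mean value
    theorem is applied between positive points. *)
Lemma powR_tangent2 a x z : 1 < a < 2 -> 0 <= x <= 1 -> 0 <= z <= 1 ->
  a^-1 * z `^ a + z `^ (a - 1) * (x - z) + (a - 1) / 2 * (x - z) ^+ 2
    <= a^-1 * x `^ a.
Proof.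
move=> /andP[a1 a2] /andP[x0 x1] /andP[z0 z1].
have a0 : 0 < a by lra.
have aV : 2^-1 <= a^-1 by rewrite lef_pV2 ?posrE ?ltW.
have sq y : 0 <= y <= 1 -> y ^+ 2 <= y `^ a.
  move=> /andP[y0 y1]; rewrite -powR_mulrn//.
  move: y0; rewrite le_eqVlt => /predU1P[<-|y0]; first by rewrite !powR0 ?gt_eqF.
  by apply: ger_powR; rewrite ?y0 ?y1 ?ltW.
have [->|xn0] := eqVneq x 0.
  rewrite (@powR0 _ a) ?gt_eqF// mulr0 sub0r sqrrN mulrN.
  rewrite (mulrC _ z) mulr_powRB1//.
  have := sq z; rewrite z0 z1 => /(_ isT) h.
  have : (a - 1) / 2 * z ^+ 2 <= (a - 1) / 2 * z `^ a by rewrite ler_wpM2l//; lra.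
  have : (a - 1) * 2^-1 * z `^ a <= (a - 1) * a^-1 * z `^ a.
    by rewrite ler_wpM2r ?powR_ge0// ler_wpM2l//; lra.
  have -> : (a - 1) * a^-1 * z `^ a = z `^ a - a^-1 * z `^ a.
    by field; rewrite gt_eqF.
  lra.
have [->|zn0] := eqVneq z 0.
  rewrite !powR0 ?gt_eqF ?subr_gt0// mulr0 mul0r !add0r subr0.
  have := sq x; rewrite x0 x1 => /(_ isT) h.
  have : 2^-1 * x `^ a <= a^-1 * x `^ a by rewrite ler_wpM2r ?powR_ge0.
  have : (a - 1) / 2 * x ^+ 2 <= (a - 1) / 2 * x `^ a by rewrite ler_wpM2l//; lra.
  have : (a - 1) / 2 * x `^ a <= 1 / 2 * x `^ a.
    by rewrite ler_wpM2r ?powR_ge0//; lra.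
  lra.
have {}x0 : 0 < x by rewrite lt_neqAle eq_sym xn0.
have {}z0 : 0 < z by rewrite lt_neqAle eq_sym zn0.
(* [k] is the Taylor remainder up to a constant; its derivative [dk] vanishes at
   [z] and is nondecreasing, so [k] is minimal at [z] *)
pose k y := a^-1 * y `^ a - (a - 1) / 2 * y ^+ 2 - (z `^ (a - 1) - (a - 1) * z) * y.
pose dk y := y `^ (a - 1) - (a - 1) * y - (z `^ (a - 1) - (a - 1) * z).
have kE y : 0 < y -> is_derive y 1 k (dk y).
  move=> y0.
  have H : is_derive y 1 (fun w : R => w `^ a) (a * y `^ (a - 1)).
    apply: DeriveDef; first by apply: derivable_powR; rewrite in_itv/= y0.
    by rewrite -derive1E powR_derive1// in_itv/= y0.
  rewrite /k; apply: is_derive_eq.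
  rewrite /dk /GRing.scale/= ; field; lra.
suff : 0 <= k x - k z.
  rewrite /k => h.
  have -> : z `^ a = z `^ (a - 1) * z by rewrite mulrC mulr_powRB1// ltW.
  move: h; have -> : z `^ a = z `^ (a - 1) * z by rewrite mulrC mulr_powRB1// ltW.
  move: (z `^ (a - 1)) (x `^ a) => p q; nra.
have mono u v : 0 < u <= v -> v <= 1 -> dk u <= dk v.
  move=> uv v1; have := @ler_powRB (a - 1) u v.
  rewrite (_ : 0 < a - 1 < 1); last by apply/andP; split; lra.
  move=> /(_ isT uv v1); rewrite /dk; lra.
have dkz : dk z = 0 by rewrite /dk subrr.
have cont u v : 0 < u -> {within `[u, v], continuous k}.
  move=> u0; apply: derivable_within_continuous => y.
  rewrite in_itv/= => /andP[uy _]; have [] // := kE y; lra.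
have [xz|zx] := leP x z.
  have [//||c] := @MVT_segment R k dk x z xz.
  - move=> y; rewrite in_itv/= => /andP[xy _]; apply: kE; lra.
  - exact: cont.
  rewrite in_itv/= => /andP[xc cz] E.
  have := mono c z; rewrite dkz cz (lt_le_trans x0 xc) z1 => /(_ isT isT) h.
  have : dk c * (z - x) <= 0 by rewrite mulr_le0_ge0// subr_ge0.
  lra.
have [||c] := @MVT_segment R k dk z x (ltW zx).
- move=> y; rewrite in_itv/= => /andP[xy _]; apply: kE; lra.
- exact: cont.
rewrite in_itv/= => /andP[zc cx] ->.
apply: mulr_ge0; last by rewrite subr_ge0 ltW.
by rewrite -dkz; apply: mono; rewrite ?z0//; lra.
Qed.

End powers.

(** * Inner products and quantitative convexity *)

Section inner_product.
Variables (R : realType) (H : completeNormedModType R).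
Variables (dot : {dot H for @idfun R}) (hH : induces_norm dot).
Implicit Types x y : H.

Lemma dotC x y : dot x y = dot y x.
Proof. by rewrite hermC expr0 mul1r. Qed.

Lemma dotDl x y z : dot (x + y) z = dot x z + dot y z.
Proof. by rewrite dotC linearD /= !(dotC z). Qed.

Lemma dotZr a x y : dot x (a *: y) = a * dot x y.
Proof. by rewrite linearZ. Qed.

Lemma dotZl a x y : dot (a *: x) y = a * dot x y.
Proof. by rewrite dotC dotZr dotC. Qed.

Lemma normD2 x y : `|x + y| ^+ 2 = `|x| ^+ 2 + 2 * dot x y + `|y| ^+ 2.
Proof.
rewrite -!hH dotDl !linearD/= (dotC y x); ring.
Qed.

Lemma normB2 x y : `|x - y| ^+ 2 = `|x| ^+ 2 - 2 * dot x y + `|y| ^+ 2.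
Proof. by rewrite normD2 normrN linearN/= mulrN. Qed.

Lemma dot_le x y : dot x y <= `|x| * `|y|.
Proof.
have h : (`|x| - `|y|) ^+ 2 <= `|x - y| ^+ 2.
  rewrite -[leLHS]real_normK ?num_real// lerXn2r ?nnegrE//; exact: ler_dist_dist.
rewrite normB2 in h; lra.
Qed.

End inner_product.

Section gaps.
Variables (R : realType) (H : completeNormedModType R).
Variables (dot : {dot H for @idfun R}) (hH : induces_norm dot).
Implicit Types (x y : H) (a l M K : R).

Definition misfit a x : R := a^-1 * `|x| `^ a.

(** [K] quantifies the convexity of [F] on the segment from [x] to [y]; the
    factor [l * (1 - l)] is the one for which a function with second derivative
    at least [m] admits the gap [m / 2 * |x - y|^2]. *)
Definition convexity_gap (F : H -> R) x y K := forall l, 0 < l < 1 ->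
  F ((1 - l) *: x + l *: y) + l * (1 - l) * K <= (1 - l) * F x + l * F y.

Lemma norm_comb2 l x y : `|(1 - l) *: x + l *: y| ^+ 2 =
  (1 - l) * `|x| ^+ 2 + l * `|y| ^+ 2 - l * (1 - l) * `|x - y| ^+ 2.
Proof.
rewrite (normB2 hH x) (normD2 hH (_ *: x)) !normrZ !exprMn !real_normK ?num_real//.
rewrite (dotZl dot) dotZr; ring.
Qed.

Lemma norm_comb_le l x y : 0 <= l <= 1 ->
  `|(1 - l) *: x + l *: y| <= (1 - l) * `|x| + l * `|y|.
Proof.
move=> /andP[l0 l1]; rewrite (le_trans (ler_normD _ _))// !normrZ.
by rewrite !ger0_norm// subr_ge0.
Qed.

(** The norm is strictly convex in the angular direction only: the gap is
    governed by the defect in the Cauchy-Schwarz inequality. *)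
Lemma convexity_gap_norm x y M : 0 < M -> `|x| <= M -> `|y| <= M ->
  convexity_gap (misfit 1) x y ((`|x| * `|y| - dot x y) / M).
Proof.
move=> M0 xM yM l /andP[l0 l1].
have l01 : 0 <= l <= 1 by rewrite !ltW.
rewrite /misfit invr1 !mul1r !powRr1//.
have n1 := norm_comb_le x y l01; have n2 := norm_comb2 l x y.
rewrite (normB2 hH) in n2; set n := `|_ + _| in n1 n2 *.
have d0 : 0 <= `|x| * `|y| - dot x y by rewrite subr_ge0; exact: dot_le.
set c := _ - dot x y in d0 *.
set S := _ + _ * `|y| in n1 *.
have SM : S <= M.
  have : (1 - l) * `|x| <= (1 - l) * M by rewrite ler_wpM2l// subr_ge0 ltW.
  have : l * `|y| <= l * M by rewrite ler_wpM2l// ltW.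
  by rewrite /S; lra.
(* the deviation of [n^2] from [S^2] only involves the Cauchy-Schwarz defect *)
have key : (S - n) * (S + n) = 2 * (l * (1 - l) * c).
  rewrite -subr_sqr n2 /S /c; ring.
rewrite -lerBrDl mulrA ler_pdivrMr//.
have : (S - n) * (S + n) <= (S - n) * (2 * M).
  by apply: ler_wpM2l; [rewrite subr_ge0|lra].
by rewrite key; lra.
Qed.

(** [F] minus [(a - 1) / 2 * |x|^2] is [h |x|] with [h] convex and nondecreasing
    on [0, 1], hence convex on the unit ball; the square contributes the gap
    exactly.  The tangents [T1], [T2] express the convexity of [h] and [T3] its
    monotonicity. *)
Lemma convexity_gap_power1 a x y : 1 < a < 2 -> `|x| <= 1 -> `|y| <= 1 ->
  convexity_gap (misfit a) x y ((a - 1) / 2 * `|x - y| ^+ 2).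
Proof.
move=> a12 x1 y1 l /andP[l0 l1]; move/andP: (a12) => [a1 a2].
have l01 : 0 <= l <= 1 by rewrite !ltW.
have n1 := norm_comb_le x y l01; have n2 := norm_comb2 l x y.
rewrite /misfit; set n := `|_ + _| in n1 n2 *.
set S := _ + _ * `|y| in n1.
have S1 : S <= 1.
  have : (1 - l) * `|x| <= (1 - l) * 1 by rewrite ler_wpM2l// subr_ge0 ltW.
  have : l * `|y| <= l * 1 by rewrite ler_wpM2l// ltW.
  by rewrite /S; lra.
have n0 : 0 <= n by exact: normr_ge0.
have nn : n <= n `^ (a - 1).
  move: n0; rewrite le_eqVlt => /predU1P[<-|n0]; first exact: powR_ge0.
  by apply: ger1_powR; lra.
have I0 (z : R) : 0 <= z -> z <= 1 -> 0 <= z <= 1 by move=> -> ->.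
have IS : 0 <= S <= 1 by apply: I0 => //; exact: le_trans n1.
have T1 := powR_tangent2 a12 (I0 _ (normr_ge0 x) x1) IS.
have T2 := powR_tangent2 a12 (I0 _ (normr_ge0 y) y1) IS.
have T3 := powR_tangent2 a12 IS (I0 _ n0 (le_trans n1 S1)).
have T4 : (a - 1) * n * (S - n) <= n `^ (a - 1) * (S - n).
  by apply: ler_wpM2r; [rewrite subr_ge0|nra].
have T12 : (1 - l) * (a^-1 * S `^ a + S `^ (a - 1) * (`|x| - S) + (a - 1) / 2 * (`|x| - S) ^+ 2)
   + l * (a^-1 * S `^ a + S `^ (a - 1) * (`|y| - S) + (a - 1) / 2 * (`|y| - S) ^+ 2)
   <= (1 - l) * (a^-1 * `|x| `^ a) + l * (a^-1 * `|y| `^ a).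
  by apply: lerD; apply: ler_wpM2l => //; lra.
apply: le_trans T12.
have -> : l * (1 - l) * ((a - 1) / 2 * `|x - y| ^+ 2) =
   (a - 1) / 2 * ((1 - l) * `|x| ^+ 2 + l * `|y| ^+ 2 - n ^+ 2).
  by rewrite n2; ring.
move: T3 T4; rewrite /S.
move: (a^-1 * n `^ a) (_ `^ (a - 1)) (a^-1 * _ `^ a) (_ `^ (a - 1)) => A B C D.
nra.
Qed.

(** By scaling from the unit ball, as the misfit is homogeneous of degree [a]. *)
Lemma convexity_gap_power a M x y : 1 < a < 2 -> 0 < M -> `|x| <= M -> `|y| <= M ->
  convexity_gap (misfit a) x y ((a - 1) / 2 * M `^ (a - 2) * `|x - y| ^+ 2).
Proof.
move=> a12 M0 xM yM l l01.
have nM (z : H) : `|M^-1 *: z| = M^-1 * `|z|.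
  by rewrite normrZ gtr0_norm// invr_gt0.
have sc (z : H) : `|z| <= M -> `|M^-1 *: z| <= 1.
  by move=> zM; rewrite nM ler_pdivrMl// mulr1.
have := convexity_gap_power1 a12 (sc _ xM) (sc _ yM) l01.
have -> : (1 - l) *: (M^-1 *: x) + l *: (M^-1 *: y) = M^-1 *: ((1 - l) *: x + l *: y).
  by rewrite scalerDr !scalerA !(mulrC M^-1).
have mM z : misfit a (M^-1 *: z) = M `^ (- a) * misfit a z.
  rewrite /misfit nM powRM ?invr_ge0 ?(ltW M0)// -[M^-1]powR_inv1 ?(ltW M0)//.
  by rewrite -powRrM mulN1r mulrCA.
rewrite -scalerBr nM !mM exprMn.
have -> : M `^ (a - 2) = M `^ a * (M^-1) ^+ 2.
  rewrite powRB ?(gt_eqF M0) ?implybT//.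
  by rewrite (_ : M `^ 2 = M ^+ 2) ?exprVn//; exact: (powR_mulrn 2 (ltW M0)).
have MM : M `^ (- a) * M `^ a = 1.
  by rewrite powRN mulVf// gt_eqF// powR_gt0.
have Ma : 0 < M `^ a by rewrite powR_gt0.
rewrite -(ler_pM2l Ma).
set P := misfit a _; set Q := misfit a x; set S := misfit a y.
have -> : M `^ a * (M `^ (- a) * P + l * (1 - l) * ((a - 1) / 2 * (M^-1 ^+ 2 * `|x - y| ^+ 2)))
  = (M `^ (- a) * M `^ a) * P + l * (1 - l) * ((a - 1) / 2 * (M `^ a * M^-1 ^+ 2) * `|x - y| ^+ 2).
  ring.
have -> : M `^ a * ((1 - l) * (M `^ (- a) * Q) + l * (M `^ (- a) * S)) =
  (M `^ (- a) * M `^ a) * ((1 - l) * Q + l * S) by ring.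
by rewrite MM !mul1r.
Qed.

End gaps.

(** * Steep balls of monotone functions *)

Section monotone.
Variable R : realType.
Local Notation mu := (@lebesgue_measure R).

Lemma exists_maximizer_seq (I : eqType) (c : I -> R) (s : seq I) :
  s != [::] -> exists2 i, i \in s & forall j, j \in s -> c j <= c i.
Proof.
elim: s => // i s IH _; have [->|/IH[k ks kmax]] := eqVneq s [::].
  by exists i; rewrite ?mem_head// => j; rewrite inE => /eqP->.
have [ki|ik] := leP (c k) (c i).
  exists i; first exact: mem_head.
  move=> j; rewrite inE => /predU1P[->//|/kmax jk]; exact: le_trans ki.
exists k; first by rewrite inE ks orbT.
by move=> j; rewrite inE => /predU1P[->|/kmax//]; exact: ltW.
Qed.

(** The intervals are peeled off from the right: an interval of maximal center
    leaves all the others to the left of its left endpoint. *)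
Lemma sum_increments_le (I : eqType) (c r : I -> R) (v : R -> R) (p q : R)
    (s : seq I) :
  p <= q -> (forall x y, p <= x -> x <= y -> y <= q -> v x <= v y) ->
  uniq s ->
  (forall i, i \in s -> [/\ 0 < r i, p <= c i - r i & c i + r i <= q]) ->
  {in s &, forall i j, i != j -> r i + r j <= `|c i - c j|} ->
  \sum_(i <- s) (v (c i + r i) - v (c i - r i)) <= v q - v p.
Proof.
have [n] := ubnP (size s); elim: n s q => // n IH s q; rewrite ltnS => sn pq vm us.
have [->|s0] := eqVneq s [::].
  by move=> _ _; rewrite big_nil subr_ge0; apply: vm.
move=> inpq dis; have [i is_ imax] := exists_maximizer_seq c s0.
have [ri pi iq] := inpq i is_.
rewrite (big_rem i)//=.
have : \sum_(j <- rem i s) (v (c j + r j) - v (c j - r j)) <= v (c i - r i) - v p.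
  apply: IH => //.
  - by rewrite size_rem// prednK// lt0n size_eq0.
  - by move=> x y px xy yi; apply: vm => //; lra.
  - exact: rem_uniq.
  - move=> j; rewrite mem_rem_uniq// !inE => /andP[ji js].
    have [rj pj jq] := inpq j js; split=> //.
    have := dis i j is_ js; rewrite eq_sym ji => /(_ isT).
    have := imax j js => cji; rewrite ger0_norm ?subr_ge0//; lra.
  - by move=> j k /mem_rem js /mem_rem ks; exact: dis.
have : v (c i + r i) <= v q by apply: vm => //; lra.
lra.
Qed.

Lemma disjoint_balls_dist (x y r s : R) : 0 < r -> 0 < s ->
  ball x r `&` ball y s = set0 -> r + s <= `|x - y|.
Proof.
move=> r0 s0 E; rewrite leNgt; apply/negP => lt.
(* if the balls were closer, the point dividing [x, y] in the ratio [r : s] would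
   belong to both *)
pose z := (x * s + y * r) / (r + s).
have : (ball x r `&` ball y s) z.
  split; rewrite /ball/= /z.
    have -> : x - (x * s + y * r) / (r + s) = (x - y) * (r / (r + s)) by field; lra.
    rewrite normrM (ger0_norm (_ : 0 <= r / _)) ?divr_ge0 ?addr_ge0 ?(ltW r0) ?(ltW s0)//.
    by rewrite mulrA ltr_pdivrMr ?addr_gt0// (mulrC r) ltr_pM2r.
  have -> : y - (x * s + y * r) / (r + s) = (y - x) * (s / (r + s)) by field; lra.
  rewrite normrM distrC (ger0_norm (_ : 0 <= s / _)) ?divr_ge0 ?addr_ge0 ?(ltW r0) ?(ltW s0)//.
  by rewrite mulrA ltr_pdivrMr ?addr_gt0// (mulrC s) ltr_pM2r.
by rewrite E.
Qed.

(** Balls are encoded as pairs of a center and a radius. *)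
Definition steep_balls (v : R -> R) (p q k : R) : set (R * {posnum R}) :=
  [set i | [/\ p <= i.1 - i.2%:num, i.1 + i.2%:num <= q
    & k * (2 * i.2%:num) < v (i.1 + i.2%:num) - v (i.1 - i.2%:num)]].

Definition steep_set v p q k : set R :=
  cover (steep_balls v p q k) (fun i => ball i.1 i.2%:num).

Lemma steep_set_open v p q k : open (steep_set v p q k).
Proof. by apply: bigcup_open => i _; exact: ball_open. Qed.

Lemma measurable_steep_set v p q k : measurable (steep_set v p q k).
Proof. by apply: open_measurable; exact: steep_set_open. Qed.

(** The weak type estimate for the maximal function of a monotone [v].  A compact
    part of the steep set is covered by finitely many steep balls; by Vitali's
    lemma disjoint ones among them cover it after tripling, and each has length
    at most [1 / k] times the increment of [v] across it. *)
Lemma measure_steep_set_le v p q k : 0 < k -> p <= q ->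
  (forall x y, p <= x -> x <= y -> y <= q -> v x <= v y) ->
  (mu (steep_set v p q k) <= (3 / k * (v q - v p))%:E)%E.
Proof.
move=> k0 pq vm.
rewrite lebesgue_regularity_inner_sup//; last exact: measurable_steep_set.
apply: ge_ereal_sup => /= x /= [K [cK KU <-{x}]].
pose B (i : R * {posnum R}) := ball i.1 i.2%:num.
have [D Dsub KD] : finite_subset_cover (steep_balls v p q k) B K.
  move: cK; rewrite compact_cover => /(_ _ _ _ _ KU); apply.
  by move=> i _; exact: ball_open.
have is_ballB i : is_ball (B i) by exact: is_ball_ball.
have Bset0 i : B i !=set0 by exists i.1; exact: ballxx.
have [E [uE ED tEB DE]] := @vitali_lemma_finite_cover _ _ B is_ballB Bset0 (finmap.enum_fset D).
have {}DE := subset_trans KD DE.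
have EG i : i \in E -> steep_balls v p q k i.
  by move=> iE; have := Dsub i (ED i iE); rewrite inE.
(* a tripled ball of radius [r] has length [6 * r] *)
apply: (@le_trans _ _ (\sum_(i <- E) (6 * i.2%:num)%:E)%E).
  pose i0 : R * {posnum R} := (0, PosNum ltr01).
  apply: (le_trans (@content_subadditive _ _ _ mu K
      (fun i => 3 *` B (nth i0 E i)) (size E) _ _ _)) => //.
  - by move=> j ?; rewrite scale_ballE//; exact: measurable_ball.
  - by apply: closed_measurable; apply: compact_closed => //; exact: Rhausdorff.
  - apply: (subset_trans DE); rewrite /cover bigcup_seq.
    by rewrite (big_nth i0)//= big_mkord.
  - rewrite [leRHS](big_nth i0) big_mkord; apply: lee_sum => i _.
    rewrite scale_ballE//.
    have -> : 6 * (nth i0 E i).2%:num = (3 * (nth i0 E i).2%:num) *+ 2.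
      by rewrite mulr2n; ring.
    by rewrite -(@lebesgue_measure_ball R (nth i0 E i).1) ?mulr_ge0.
rewrite sumEFin lee_fin.
apply: (@le_trans _ _ (3 / k * \sum_(i <- E)
    (v (i.1 + i.2%:num) - v (i.1 - i.2%:num)))).
  rewrite mulr_sumr [leLHS]big_seq [leRHS]big_seq; apply: ler_sum => i /EG[_ _ h].
  have -> : 6 * i.2%:num = 3 / k * (k * (2 * i.2%:num)) by field; lra.
  by rewrite ler_wpM2l ?ltW// divr_gt0.
rewrite ler_wpM2l ?divr_ge0 ?(ltW k0)//.
apply: (sum_increments_le (c := fun i : R * {posnum R} => i.1)
  (r := fun i => i.2%:num)) => //.
  by move=> i /EG[? ? _].
move=> i j iE jE ij; apply: disjoint_balls_dist => //.
by move/trivIsetP : tEB; apply.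
Qed.

Lemma negligible_small_cover (N : set R) :
  (forall e, 0 < e -> exists U, [/\ measurable U, N `<=` U & (mu U <= e%:E)%E]) ->
  mu.-negligible N.
Proof.
move=> small.
have /choice[U HU] : forall n : nat, exists U, [/\ measurable U, N `<=` U
    & (mu U <= (n.+1%:R^-1)%:E)%E].
  by move=> n; apply: small; rewrite invr_gt0.
exists (\bigcap_n U n); split.
- by apply: bigcapT_measurable => n; have [] := HU n.
- apply/eqP; rewrite eq_le measure_ge0 andbT; apply/lee_addgt0Pr => e e0.
  rewrite add0e.
  have [n ne] : exists n : nat, n.+1%:R^-1 <= e.
    exists (Num.truncn e^-1); rewrite -[e in leRHS]invrK lef_pV2 ?posrE ?invr_gt0//.
    by apply/ltW/truncnS_gt.
  have [mUn _ Un] := HU n.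
  apply: (@le_trans _ _ (mu (U n))).
    apply: le_measure => //; rewrite ?inE//.
      by apply: bigcapT_measurable => m; have [] := HU m.
    exact: bigcap_inf.
  by rewrite (le_trans Un)// lee_fin.
- by move=> t Nt n _; have [_ + _] := HU n; apply.
Qed.

End monotone.

(** * Riesz variation *)

Section riesz_variation.
Variables (R : realType) (H : completeNormedModType R).
Implicit Types (g : R -> H) (a b c : R) (s : seq R).

Definition riesz_quotient g a b := `|g b - g a| ^+ 2 / (b - a).

Fixpoint riesz_sum g a s :=
  if s is b :: s' then riesz_quotient g a b + riesz_sum g b s' else 0.

Definition chains a b : set (seq R) := [set s | path <%R a s /\ last a s = b].

(** For a [g] with square integrable derivative this is the integral of the
    squared norm of the derivative. *)
Definition riesz_variation g a b := sup [set riesz_sum g a s | s in chains a b].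

Lemma riesz_sum_cat g a s1 s2 :
  riesz_sum g a (s1 ++ s2) = riesz_sum g a s1 + riesz_sum g (last a s1) s2.
Proof. by elim: s1 a => [|b s1 IH] a /=; rewrite ?add0r// IH addrA. Qed.

Lemma chain_cat a b c s1 s2 :
  chains a b s1 -> chains b c s2 -> chains a c (s1 ++ s2).
Proof.
by move=> [p1 l1] [p2 l2]; split; rewrite ?cat_path ?last_cat l1// p1 p2.
Qed.

Lemma chains_nonempty a b : a <= b -> chains a b !=set0.
Proof.
rewrite le_eqVlt => /predU1P[->|ab]; first by exists [::].
by exists [:: b]; split => //=; rewrite ab.
Qed.

Lemma chain_le a s : path <%R a s -> a <= last a s.
Proof.
elim: s a => //= b s IH a /andP[ab /IH]; exact/le_trans/ltW.
Qed.

Section lipschitz.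
Variables (g : R -> H) (L : R).
Hypothesis gL : forall x y, `|g x - g y| <= L * `|x - y|.

Lemma riesz_sum_le a s : path <%R a s ->
  riesz_sum g a s <= L ^+ 2 * (last a s - a).
Proof.
elim: s a => [|b s IH] a /=; first by rewrite subrr mulr0.
move=> /andP[ab /IH IHb].
have ba : 0 < b - a by rewrite subr_gt0.
have : riesz_quotient g a b <= L ^+ 2 * (b - a).
  rewrite ler_pdivrMr// -mulrA -expr2 -exprMn lerXn2r ?nnegrE//.
    by have := gL b a; rewrite (gtr0_norm ba); apply: le_trans.
  by have := gL b a; rewrite (gtr0_norm ba).
lra.
Qed.

Lemma riesz_sums_has_sup a b : a <= b ->
  has_sup [set riesz_sum g a s | s in chains a b].
Proof.
move=> ab; split.
  by have [s cs] := chains_nonempty ab; exists (riesz_sum g a s), s.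
by exists (L ^+ 2 * (b - a)) => _ [s [ps <-] <-]; exact: riesz_sum_le.
Qed.

Lemma riesz_sum_le_variation a b s : chains a b s ->
  riesz_sum g a s <= riesz_variation g a b.
Proof.
move=> cs; apply: ub_le_sup; last by exists s.
apply: (riesz_sums_has_sup _).2.
by case: cs => /chain_le + <-.
Qed.

Lemma riesz_quotient_le_variation a b : a < b ->
  riesz_quotient g a b <= riesz_variation g a b.
Proof.
move=> ab; have := @riesz_sum_le_variation a b [:: b].
by rewrite /= addr0; apply; split; rewrite //= ab.
Qed.

Lemma riesz_variation_ge0 a b : a <= b -> 0 <= riesz_variation g a b.
Proof.
rewrite le_eqVlt => /predU1P[->|ab].
  by have := @riesz_sum_le_variation b b [::]; apply.
apply: le_trans (riesz_quotient_le_variation ab).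
by rewrite divr_ge0 ?exprn_ge0// subr_ge0 ltW.
Qed.

Lemma riesz_variation_superadditive a b c : a <= b -> b <= c ->
  riesz_variation g a b + riesz_variation g b c <= riesz_variation g a c.
Proof.
move=> ab bc; rewrite -lerBrDr; apply: ge_sup.
  exact: (riesz_sums_has_sup ab).1.
move=> _ [s1 c1 <-]; rewrite lerBrDr -lerBrDl; apply: ge_sup.
  exact: (riesz_sums_has_sup bc).1.
move=> _ [s2 c2 <-]; rewrite lerBrDl.
have := riesz_sum_le_variation (chain_cat c1 c2).
by rewrite riesz_sum_cat; case: c1 => _ ->.
Qed.

Lemma riesz_variation_mono p x y : p <= x -> x <= y ->
  riesz_variation g p x <= riesz_variation g p y.
Proof.
move=> px xy; apply: le_trans (riesz_variation_superadditive px xy).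
by rewrite lerDl riesz_variation_ge0.
Qed.

End lipschitz.

Variables (dot : {dot H for @idfun R}) (hH : induces_norm dot).

Definition mean_slope g a b : H := (b - a)^-1 *: (g b - g a).

(** The square is expanded on each step; the cross terms and the quadratic terms
    telescope. *)
Lemma riesz_sum_affine g (D : H) a s : path <%R a s ->
  riesz_sum (fun t => g t - t *: D) a s =
  riesz_sum g a s - 2 * dot D (g (last a s) - g a)
    + `|D| ^+ 2 * (last a s - a).
Proof.
elim: s a => [|b s IH] a /=; first by rewrite !subrr linear0 !mulr0 subr0 addr0.
move=> /andP[ab /IH ->].
have ba : 0 < b - a by rewrite subr_gt0.
have -> : riesz_quotient (fun t => g t - t *: D) a b =
    riesz_quotient g a b - 2 * dot D (g b - g a) + `|D| ^+ 2 * (b - a).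
  rewrite /riesz_quotient.
  have -> : g b - b *: D - (g a - a *: D) = (g b - g a) - (b - a) *: D.
    by rewrite scalerBl !opprD !opprK addrACA.
  rewrite (normB2 hH) dotZr dotC normrZ exprMn (gtr0_norm ba); field.
  by rewrite gt_eqF.
have -> : g (last b s) - g a = (g (last b s) - g b) + (g b - g a).
  by rewrite addrA subrK.
rewrite linearD/=; ring.
Qed.

(** Pythagoras: the slopes along a chain average to the mean slope. *)
Lemma riesz_sum_mean_slope g a s : a < last a s -> path <%R a s ->
  let b := last a s in
  riesz_sum (fun t => g t - t *: mean_slope g a b) a s =
  riesz_sum g a s - riesz_quotient g a b.
Proof.
move=> ab ps b; rewrite riesz_sum_affine// -/b /mean_slope.
have ba : 0 < b - a by rewrite subr_gt0.
rewrite (dotZl dot) hH normrZ exprMn /riesz_quotient normfV gtr0_norm//; field.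
by rewrite gt_eqF.
Qed.

Lemma affine_lipschitz g (D : H) L : (forall x y, `|g x - g y| <= L * `|x - y|) ->
  forall x y, `|(g x - x *: D) - (g y - y *: D)| <= (L + `|D|) * `|x - y|.
Proof.
move=> gL x y.
have -> : g x - x *: D - (g y - y *: D) = (g x - g y) - (x - y) *: D.
  by rewrite scalerBl !opprD !opprK addrACA.
rewrite (le_trans (ler_normB _ _))// mulrDl lerD// normrZ mulrC//.
Qed.

Lemma riesz_variation_mean_slope g L a b : a < b ->
  (forall x y, `|g x - g y| <= L * `|x - y|) ->
  riesz_variation (fun t => g t - t *: mean_slope g a b) a b <=
  riesz_variation g a b - riesz_quotient g a b.
Proof.
move=> ab gL; apply: ge_sup.
  exact: (riesz_sums_has_sup (affine_lipschitz _ gL) (ltW ab)).1.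
move=> _ [s [ps lb] <-].
have := @riesz_sum_mean_slope g a s; rewrite lb => /(_ ab ps) /= ->.
by rewrite lerD2r; apply: riesz_sum_le_variation.
Qed.

End riesz_variation.

(** * Almost everywhere differentiability of Lipschitz maps *)

Section rademacher.
Variables (R : realType) (H : completeNormedModType R).
Variables (dot : {dot H for @idfun R}) (hH : induces_norm dot).
Local Notation mu := (@lebesgue_measure R).
Implicit Types (g : R -> H) (e : R).

(** To be applied to the remainder that a candidate slope leaves over. *)
Definition oscillates g e t :=
  forall d, 0 < d -> exists h, 0 < `|h| < d /\ e * `|h| < `|g (t + h) - g t|.

(** [v = riesz_variation g p] is nondecreasing and
    [|g y - g x|^2 <= (y - x) * (v y - v x)], so where [g] oscillates by [e] the
    function [v] is steep, and the weak type estimate applies. *)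
Lemma oscillation_cover g L p q e : p <= q -> 0 < e ->
  (forall x y, `|g x - g y| <= L * `|x - y|) ->
  exists U, [/\ measurable U,
    (forall t, p < t < q -> oscillates g e t -> U t)
    & (mu U <= (6 / e ^+ 2 * riesz_variation g p q)%:E)%E].
Proof.
move=> pq e0 gL; pose v := riesz_variation g p.
have e20 : 0 < e ^+ 2 / 2 by rewrite divr_gt0// exprn_gt0.
have vm x y : p <= x -> x <= y -> y <= q -> v x <= v y.
  by move=> px xy _; exact: (riesz_variation_mono gL).
exists (steep_set v p q (e ^+ 2 / 2)); split.
- exact: measurable_steep_set.
- move=> t /andP[pt tq] osc.
  have [|h [/andP[h0 hd] gh]] := osc (Num.min (t - p) (q - t)).
    by rewrite lt_min !subr_gt0 pt.
  move: hd; rewrite lt_min => /andP[hp hq].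
  (* the ball around [t] contains the interval from [t] to [t + h] and has twice its
     length, whence the slope [e^2 / 2] instead of [e^2] *)
  exists (t, PosNum h0); last by rewrite /ball/= subrr normr0.
  split => /=; [lra|lra|].
  have tht : t - `|h| < t by lra.
  have tth : t < t + `|h| by lra.
  have ptm : p <= t - `|h| by lra.
  have big : e ^+ 2 * `|h| < Num.max (riesz_quotient g (t - `|h|) t)
                             (riesz_quotient g t (t + `|h|)).
    rewrite lt_max; apply/orP.
    have sq : e ^+ 2 * `|h| < `|g (t + h) - g t| ^+ 2 / `|h|.
      rewrite ltr_pdivlMr// -mulrA -expr2 -exprMn ltrXn2r// ?nnegrE//.
      by rewrite mulr_ge0// ltW.
    have [hn|hpos] := ltP h 0.
      left; rewrite /riesz_quotient (_ : t - (t - `|h|) = `|h|); last by ring.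
      by rewrite distrC ltr0_norm ?opprK// -ltr0_norm.
    right; rewrite /riesz_quotient (_ : t + `|h| - t = `|h|); last by ring.
    by rewrite {2}ger0_norm.
  rewrite (_ : e ^+ 2 / 2 * (2 * `|h|) = e ^+ 2 * `|h|); last by field.
  apply: (lt_le_trans big).
  have s1 := riesz_variation_superadditive gL ptm (ltW (lt_trans tht tth)).
  have s2 := riesz_variation_superadditive gL (ltW tht) (ltW tth).
  have q1 := riesz_quotient_le_variation gL tht.
  have q2 := riesz_quotient_le_variation gL tth.
  have v1 := riesz_variation_ge0 gL (ltW tht).
  have v2 := riesz_variation_ge0 gL (ltW tth).
  by rewrite /v ge_max; apply/andP; split; lra.
- apply: (le_trans (measure_steep_set_le e20 pq vm)); rewrite lee_fin.
  rewrite (_ : 3 / (e ^+ 2 / 2) = 6 / e ^+ 2); last by field; rewrite gt_eqF.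
  rewrite ler_wpM2l ?divr_ge0 ?exprn_ge0 ?(ltW e0)//.
  by rewrite /v gerBl (riesz_variation_ge0 gL).
Qed.

Definition non_derivable_at g e t :=
  forall D : H, oscillates (fun x => g x - x *: D) e t.

(** On each interval of the chain the affine function with the mean slope of [g]
    is a candidate; what it leaves over has variation at most the excess of the
    variation over the quotient of the interval, and these excesses add up. *)
Lemma non_derivable_cover_chain g L e a s : 0 < e ->
  (forall x y, `|g x - g y| <= L * `|x - y|) -> path <%R a s ->
  exists U, [/\ measurable U,
    (forall t, a < t < last a s -> non_derivable_at g e t -> U t)
    & (mu U <= (6 / e ^+ 2 *
        (riesz_variation g a (last a s) - riesz_sum g a s))%:E)%E].
Proof.
move=> e0 gL; have c0 : 0 <= 6 / e ^+ 2 by rewrite divr_ge0 ?exprn_ge0 ?ltW.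
elim: s a => [|b s IH] a.
  move=> _; exists set0; split => //=.
    by move=> t /andP[/lt_trans h /h]; rewrite ltxx.
  rewrite measure0 lee_fin mulr_ge0// subr_ge0.
  exact: (@riesz_sum_le_variation _ _ _ _ gL a a [::]).
move=> /= /andP[ab ps]; have [U [mU nU lU]] := IH b ps.
have D := affine_lipschitz (mean_slope g a b) gL.
have [V [mV nV lV]] := oscillation_cover (ltW ab) e0 D.
(* the chain point [b] itself belongs to neither open interval *)
exists (V `|` [set b] `|` U); split.
- by do 2!apply: measurableU => //.
- move=> t /andP[ta tl] nt; have [tb|bt|->] := ltgtP t b.
  + by left; left; apply: nV; rewrite ?ta ?tb//; exact: nt.
  + by right; apply: nU; rewrite ?bt ?tl.
  + by left; right.
- rewrite (le_trans (measureU2 _ _ _))//; first exact: measurableU.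
  apply: (@le_trans _ _ ((6 / e ^+ 2 * (riesz_variation g a b - riesz_quotient g a b))%:E
     + (6 / e ^+ 2 * (riesz_variation g b (last b s) - riesz_sum g b s))%:E)%E).
    apply: leeD => //; rewrite (le_trans (measureU2 _ _ _))//.
    rewrite [X in (_ + X)%E]lebesgue_measure_set1 adde0 (le_trans lV)// lee_fin ler_wpM2l//.
    exact: (riesz_variation_mean_slope hH ab gL).
  rewrite -EFinD lee_fin -mulrDr ler_wpM2l//.
  have := riesz_variation_superadditive gL (ltW ab) (chain_le ps).
  lra.
Qed.

(** The chain may be chosen with a Riesz sum as close to the variation as desired. *)
Lemma negligible_non_derivable_itv g L e p q : p < q -> 0 < e ->
  (forall x y, `|g x - g y| <= L * `|x - y|) ->
  mu.-negligible [set t | p < t < q /\ non_derivable_at g e t].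
Proof.
move=> pq e0 gL; apply: negligible_small_cover => n n0.
have c0 : 0 < 6 / e ^+ 2 by rewrite divr_gt0 ?exprn_gt0.
have [_ [s [ps lq] <-]] :=
  @sup_adherent _ _ (n / (6 / e ^+ 2)) (divr_gt0 n0 c0) (riesz_sums_has_sup gL (ltW pq)).
rewrite -/(riesz_variation g p q) => close.
have [U [mU nU lU]] := non_derivable_cover_chain e0 gL ps.
exists U; split => //.
  by move=> t [tpq nt]; apply: nU; rewrite ?lq.
rewrite (le_trans lU)// lee_fin lq mulrC -ler_pdivlMr//.
by rewrite lerBlDl -lerBlDr ltW.
Qed.

Lemma negligible_non_derivable g L :
  (forall x y, `|g x - g y| <= L * `|x - y|) ->
  mu.-negligible [set t | exists2 e, 0 < e & non_derivable_at g e t].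
Proof.
move=> gL.
apply: (@negligibleS _ _ _ mu (\bigcup_n [set t | - n.+1%:R < t < n.+1%:R /\
   non_derivable_at g n.+1%:R^-1 t])); last first.
  apply: negligible_bigcup => n; apply: (negligible_non_derivable_itv _ _ gL).
    by rewrite -subr_gt0 opprK addr_gt0.
  by rewrite invr_gt0.
move=> t [e e0 nt].
pose n := maxn (Num.truncn e^-1) (Num.truncn `|t|).
exists n => //; split.
  rewrite -ltr_norml (lt_le_trans (truncnS_gt _))// ler_nat ltnS leq_maxr//.
move=> D d d0; have [h [hd gh]] := nt D d d0; exists h; split=> //.
apply: le_lt_trans gh; rewrite ler_wpM2r// -[leRHS]invrK lef_pV2 ?posrE ?invr_gt0//.
by rewrite (le_trans (ltW (truncnS_gt _)))// ler_nat ltnS leq_maxl.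
Qed.

(** Slopes that fit within every [e] make the difference quotients a Cauchy
    family, without any candidate for the derivative. *)
Lemma derivable_of_approx_slopes (g : R^o -> H) (t : R) :
  (forall e, 0 < e -> exists D : H, exists2 d : R, 0 < d &
     forall h : R, 0 < `|h| < d -> `|g (t + h) - g t - h *: D| <= e * `|h|) ->
  derivable g t 1.
Proof.
move=> approx; apply: cauchy_cvg; apply: cauchy_exP => e e0.
have [D [d d0 gd]] := approx (e / 2) (divr_gt0 e0 (ltr0n R 2)).
exists D; rewrite /fmap/=.
near=> h; rewrite -ball_normE /=.
have h0 : h != 0 by near: h; exact: nbhs_dnbhs_neq.
have hd : `|h| < d by near: h; apply: dnbhs0_lt.
rewrite /= /shift /= -[D](scalerK h0) -scalerBr normrZ normfV.
rewrite -ltr_pdivlMl ?invr_gt0 ?normr_gt0// invrK distrC.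
rewrite (_ : h *: (1 : R^o) = h); last by rewrite /GRing.scale/= mulr1.
rewrite (addrC h).
have := gd h; rewrite normr_gt0 h0 hd => /(_ isT) G; apply: (le_lt_trans G).
by rewrite mulrC ltr_pM2l ?normr_gt0//; lra.
Unshelve. all: by end_near. Qed.

(** Rademacher's theorem in one variable, for Hilbert space valued maps. *)
Theorem lipschitz_ae_derivable (g : R^o -> H) L :
  (forall x y : R, `|g x - g y| <= L * `|x - y|) ->
  {ae mu, forall t, derivable g t 1}.
Proof.
move=> gL; apply: (negligibleS _ (negligible_non_derivable gL)).
move=> t /=; apply: contra_notP => nt; apply: derivable_of_approx_slopes => e e0.
apply: contrapT => no; apply: nt; exists e => // D d d0.
apply: contrapT => noh; apply: no; exists D, d => // h hd.
rewrite leNgt; apply/negP => lt; apply: noh; exists h; split => //.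
have -> // : g (t + h) - (t + h) *: D - (g t - t *: D) = g (t + h) - g t - h *: D.
rewrite scalerDl !opprD !opprK addrACA; congr (_ + _).
by rewrite addrC addNKr.
Qed.

End rademacher.

Lemma ae_imply (R : realType) (P Q : R -> Prop) : (forall t, P t -> Q t) ->
  {ae @lebesgue_measure R, forall t, P t} -> {ae @lebesgue_measure R, forall t, Q t}.
Proof. by move=> PQ; apply: negligibleS => t /= nQ /PQ. Qed.

Section derivative_bounds.
Variables (R : realType) (H : completeNormedModType R).
Local Notation mu := (@lebesgue_measure R).

Lemma norm_derive1_le (g : R^o -> H) (t C : R) : derivable g t 1 ->
  (forall e, 0 < e -> exists2 d : R, 0 < d & forall h : R, 0 < `|h| < d ->
     `|g (t + h) - g t| <= (C + e) * `|h|) ->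
  `|derive1 g t| <= C.
Proof.
move=> dg bound; apply/ler_addgt0Pr => e e0.
have [d d0 hd] := bound e e0.
have cg : cvg ((fun h : R => h^-1 *: (g (h + t) - g t)) @ 0^').
  have -> : (fun h : R => h^-1 *: (g (h + t) - g t)) =
            (fun h : R => h^-1 *: ((g \o shift t) (h *: (1 : R^o)) - g t)).
    by apply/funext => h /=; rewrite [h *: _]mulr1.
  exact: dg.
rewrite /derive1 -lim_norm//; apply: limr_le; first exact: is_cvg_norm.
near=> h.
have h0 : 0 < `|h| by rewrite normr_gt0; near: h; exact: nbhs_dnbhs_neq.
have hd' : `|h| < d by near: h; apply: dnbhs0_lt.
rewrite normrZ normfV ler_pdivrMl// mulrC (addrC h); apply: hd.
by rewrite h0 hd'.
Unshelve. all: by end_near. Qed.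

Variables (dot : {dot H for @idfun R}) (hH : induces_norm dot).

(** On [x > d] the map agrees with its composition with [max(., d)], which is
    Lipschitz on the whole line. *)
Lemma locally_lipschitz_ae_derivable (g : R^o -> H) :
  (forall d : R, 0 < d -> exists2 L : R, 0 <= L & forall s t : R,
     d < s -> d < t -> `|g t - g s| <= L * `|t - s|) ->
  {ae mu, forall t : R, 0 < t -> derivable g t 1}.
Proof.
move=> gL; pose d (n : nat) : R := n.+1%:R^-1.
have d0 n : 0 < d n by rewrite invr_gt0.
have nder n : {ae mu, forall t : R, d n < t -> derivable g t 1}.
  have [L L0 hL] := gL (d n / 2) (divr_gt0 (d0 n) (ltr0n R 2)).
  pose gn : R^o -> H := fun t : R => g (Num.max t (d n)).
  have gnL (x y : R) : `|gn x - gn y| <= L * `|x - y|.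
    have big (z : R) : d n / 2 < Num.max z (d n).
      by rewrite lt_max; apply/orP; right; have := d0 n; lra.
    apply: le_trans (hL _ _ (big y) (big x)) _; rewrite ler_wpM2l//.
    case: (leP x (d n)) => xd; case: (leP y (d n)) => yd //.
    - by rewrite subrr normr0.
    - rewrite !ltr0_norm ?subr_lt0//; last exact: le_lt_trans yd.
      by rewrite lerN2 lerB.
    - rewrite !gtr0_norm ?subr_gt0//; last exact: le_lt_trans xd.
      by rewrite lerB.
  have := lipschitz_ae_derivable hH gnL; apply: ae_imply => t dt dnt.
  apply: near_eq_derivable dt => //.
  near=> x; rewrite /gn max_l//; apply/ltW; near: x.
  exact: lt_nbhsr.
apply: (negligibleS _ (negligible_bigcup nder)) => t /= /not_implyP[t0 nt].
have [n nt'] : exists n, d n < t.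
  exists (Num.truncn t^-1); rewrite /d -[ltRHS]invrK ltf_pV2 ?posrE ?invr_gt0//.
  exact: truncnS_gt.
by exists n => //= /(_ nt').
Unshelve. all: by end_near. Qed.

End derivative_bounds.

(** * Energy comparison for minimizers *)

(** The passage to the limit [l -> 0] in inequalities tested on segments. *)
Lemma le_of_onem (R : realType) (a b K : R) :
  (forall l, 0 < l < 1 -> a + (1 - l) * K <= b) -> a + K <= b.
Proof.
move=> h; apply/ler_addgt0Pr => e e0.
pose l := Num.min 2^-1 (e / (`|K| + 1)).
have K1 : 0 < `|K| + 1 by rewrite ltr_wpDl.
have l0 : 0 < l by rewrite lt_min invr_gt0 ltr0n divr_gt0.
have l1 : l < 1 by rewrite gt_min invf_lt1 ?ltr1n.
have lK : l * K <= e.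
  have : l * (`|K| + 1) <= e by rewrite -ler_pdivlMr// ge_min lexx orbT.
  have : l * K <= l * `|K| by rewrite ler_wpM2l ?(ltW l0)// ler_norm.
  lra.
by have := h l; rewrite l0 l1 => /(_ isT); lra.
Qed.

Section minimizers.
Variables (R : realType) (X H : completeNormedModType R).
Variables (dot : {dot H for @idfun R}) (hH : induces_norm dot).
Variables (A : {linear X -> H}) (J : X -> \bar R).
Hypothesis J_ge0 : forall u, (0 <= J u)%E.
Hypothesis J_convex : convex_functional J.
Hypothesis J_hom : absolutely_one_homogeneous J.
Variables (f : H) (alpha beta : R).
Hypothesis alpha1 : 1 <= alpha.
Hypothesis beta1 : 1 <= beta.

Implicit Types (t s l : R) (u v : X).

Local Notation minimizer t := (is_minimizer (energy A J f alpha beta t)).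
Local Notation j u := (fine (J u)).
Local Notation w u := (A u - f).

Let alpha0 : 0 < alpha. Proof. exact: lt_le_trans alpha1. Qed.
Let beta0 : 0 < beta. Proof. exact: lt_le_trans beta1. Qed.

Lemma functional0 : J 0 = 0%E.
Proof. by have := J_hom 0 0; rewrite scale0r normr0 mul0e. Qed.

Lemma energyE t u : J u \is a fin_num ->
  energy A J f alpha beta t u = (misfit alpha (w u) + t / beta * j u `^ beta)%:E.
Proof. by move=> ufin; rewrite /energy -{1}(fineK ufin). Qed.

(** A minimizer does no worse than [0], whose energy is finite. *)
Lemma minimizer_fin_num t u : 0 < t -> minimizer t u -> J u \is a fin_num.
Proof.
move=> t0 /(_ 0); rewrite [X in (_ <= X)%E]energyE ?functional0// /energy.
case E : (J u) (J_ge0 u) => [r| |]//= _; rewrite ?gt_eqF//.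
by rewrite gt0_muley ?lte_fin ?divr_gt0// addey// leNgt ltry.
Qed.

Lemma fine_functional_ge0 u : 0 <= j u.
Proof. exact: fine_ge0. Qed.

(** The energy of [u] is compared with that of [(1 - l) * u + l * v], where [J] is
    bounded by convexity. *)
Lemma minimizer_segment t u v l : 0 < t -> minimizer t u -> J v \is a fin_num ->
  0 <= l <= 1 ->
  misfit alpha (w u) + t / beta * j u `^ beta <=
  misfit alpha ((1 - l) *: w u + l *: w v)
    + t / beta * ((1 - l) * j u + l * j v) `^ beta.
Proof.
move=> t0 mu vfin l01; have ufin := minimizer_fin_num t0 mu.
move/andP : (l01) => [l0 l1].
pose z := l *: v + (1 - l) *: u.
have Jz : (J z <= (l * j v + (1 - l) * j u)%:E)%E.
  by have := J_convex v u l01; rewrite -(fineK ufin) -(fineK vfin).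
have zfin : J z \is a fin_num.
  by rewrite ge0_fin_numE// (le_lt_trans Jz)// ltry.
have := mu z; rewrite !energyE// lee_fin => /le_trans; apply.
have -> : w z = (1 - l) *: w u + l *: w v.
  rewrite /z linearD !linearZ/= !scalerBr addrACA -opprD -scalerDl subrK scale1r.
  by congr (_ - _); rewrite addrC.
rewrite lerD2l ler_wpM2l ?divr_ge0 ?(ltW t0) ?(ltW beta0)//.
rewrite ge0_ler_powR ?nnegrE ?fine_functional_ge0 ?(ltW beta0)//.
  by rewrite addr_ge0// mulr_ge0 ?fine_functional_ge0// subr_ge0.
by rewrite addrC -lee_fin fineK.
Qed.

(** The variational inequality of the minimizer.  It is strong enough to replace
    the optimality condition and involves no derivative of the misfit, which is
    not differentiable at [0] for [alpha = 1]. *)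
Lemma minimizer_gap t u v K : 0 < t -> minimizer t u -> J v \is a fin_num ->
  convexity_gap (misfit alpha) (w u) (w v) K ->
  misfit alpha (w u) - misfit alpha (w v) + K <=
    t / beta * (j v `^ beta - j u `^ beta).
Proof.
move=> t0 mu vfin gap; apply: le_of_onem => l /andP[l0 l1].
have l01 : 0 <= l <= 1 by rewrite !ltW.
have seg := minimizer_segment t0 mu vfin l01.
have {}gap := gap l; rewrite l0 l1 in gap; have {}gap := gap isT.
have cv := powR_convex beta1 l01 (fine_functional_ge0 u) (fine_functional_ge0 v).
have : t / beta * ((1 - l) * j u + l * j v) `^ beta <=
   t / beta * ((1 - l) * j u `^ beta + l * j v `^ beta).
  by rewrite ler_wpM2l ?divr_ge0 ?(ltW t0) ?(ltW beta0).
set c := t / beta => cv'.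
rewrite -(ler_pM2l l0).
move: seg gap cv'; rewrite -/c.
set P := misfit _ (_ + _); set Q := misfit _ _; set S := misfit _ _.
set Y := _ `^ _; set Z := (_ + _) `^ _; set W := j v `^ _.
move=> h1 h2 h3; lra.
Qed.

Lemma minimizer_residual_le t u : 0 < t -> minimizer t u -> `|w u| <= `|f|.
Proof.
move=> t0 mu; have := mu 0.
rewrite !energyE ?functional0 ?(minimizer_fin_num t0 mu)//= linear0 sub0r.
rewrite powR0 ?gt_eqF// mulr0 addr0 lee_fin /misfit normrN => h.
have : alpha^-1 * `|w u| `^ alpha <= alpha^-1 * `|f| `^ alpha.
  apply: le_trans h; rewrite lerDl mulr_ge0 ?powR_ge0// divr_ge0 ?(ltW t0) ?(ltW beta0)//.
rewrite ler_pM2l ?invr_gt0// => {}h; rewrite leNgt; apply/negP => lt.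
by move: h; rewrite leNgt gt0_ltr_powR// nnegrE.
Qed.

Lemma minimizer_functional_le t u : 0 < t -> minimizer t u ->
  t / beta * j u `^ beta <= misfit alpha f.
Proof.
move=> t0 mu; have := mu 0.
rewrite !energyE ?functional0 ?(minimizer_fin_num t0 mu)//= linear0 sub0r.
rewrite powR0 ?gt_eqF// mulr0 addr0 lee_fin /misfit normrN => h.
by apply: le_trans h; rewrite lerDr mulr_ge0 ?powR_ge0// invr_ge0 ltW.
Qed.

Lemma misfit_lipschitz (x y : H) M : `|x| <= M -> `|y| <= M ->
  misfit alpha x - misfit alpha y <= M `^ (alpha - 1) * `|x - y|.
Proof.
move=> xM yM; have tg := powR_tangent alpha1 (normr_ge0 x) (normr_ge0 y).
rewrite /misfit -mulrBr ler_pdivrMl//; apply: le_trans tg _.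
rewrite ler_wpM2l ?(ltW alpha0)//.
apply: (@le_trans _ _ (`|x| `^ (alpha - 1) * `|x - y|)).
  by rewrite ler_wpM2l ?powR_ge0// lerB_dist.
rewrite ler_wpM2r// ge0_ler_powR ?nnegrE ?subr_ge0//.
exact: le_trans xM.
Qed.

(** With [s] times the variational inequality at [t] and [t] times the one at [s],
    the penalty terms cancel and
    [(s + t) * K <= (t - s) * (F (w t) - F (w s))]; the right-hand side is only
    linear in [|w t - w s|]. *)
Lemma path_increment_le t s u v M : 1 < alpha < 2 -> 0 < t -> 0 < s ->
  minimizer t u -> minimizer s v -> 0 < M -> `|w u| <= M -> `|w v| <= M ->
  `|A u - A v| * ((alpha - 1) * (t + s)) <= 2 * M * `|t - s|.
Proof.
move=> a12 t0 s0 mu mv M0 uM vM; have /andP[a1 a2] := a12.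
have uv : w u - w v = A u - A v by rewrite opprB addrA subrK.
have G1 := minimizer_gap t0 mu (minimizer_fin_num s0 mv)
  (convexity_gap_power hH a12 M0 uM vM).
have G2 := minimizer_gap s0 mv (minimizer_fin_num t0 mu)
  (convexity_gap_power hH a12 M0 vM uM).
rewrite (distrC (w v)) uv in G2; rewrite uv in G1.
have L1 := misfit_lipschitz uM vM; have L2 := misfit_lipschitz vM uM.
rewrite (distrC (w v)) uv in L2; rewrite uv in L1.
have [->|D0] := eqVneq `|A u - A v| 0; first by rewrite mul0r !mulr_ge0 ?(ltW M0).
have {}D0 : 0 < `|A u - A v| by rewrite lt_neqAle eq_sym D0 normr_ge0.
have m0 : 0 < M `^ (alpha - 2) by rewrite powR_gt0.
have Mm : M `^ (alpha - 1) = M `^ (alpha - 2) * M.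
  rewrite -mulr_powRB1 ?(ltW M0) ?subr_gt0// mulrC.
  by congr (_ `^ _ * _); ring.
rewrite Mm in L1 L2.
have G : (s + t) * ((alpha - 1) / 2 * M `^ (alpha - 2) * `|A u - A v| ^+ 2) <=
   (t - s) * (misfit alpha (w u) - misfit alpha (w v)).
  have G1' := ler_wpM2l (ltW s0) G1; have G2' := ler_wpM2l (ltW t0) G2.
  have E : s * (t / beta * (j v `^ beta - j u `^ beta)) =
           - (t * (s / beta * (j u `^ beta - j v `^ beta))) by ring.
  rewrite E in G1'; lra.
have L : (t - s) * (misfit alpha (w u) - misfit alpha (w v)) <=
   `|t - s| * (M `^ (alpha - 2) * M * `|A u - A v|).
  rewrite (le_trans (ler_norm _))// normrM ler_wpM2l// ler_norml.
  by apply/andP; split => //; lra.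
have mD : 0 < M `^ (alpha - 2) * `|A u - A v| by rewrite mulr_gt0.
rewrite -(ler_pM2l mD).
move: (le_trans G L); set m := M `^ _; set D := `|A u - A v|; set d := `|t - s|.
move=> h; have -> : m * D * (D * ((alpha - 1) * (t + s))) =
  2 * ((s + t) * ((alpha - 1) / 2 * m * D ^+ 2)) by field.
have -> : m * D * (2 * M * d) = 2 * (d * (m * M * D)) by ring.
by rewrite ler_pM2l.
Qed.

(** The derivative of [x^beta] at the penalty is replaced by its tangent at the
    intermediate point, which is the sharp form needed to compare the effective
    parameters [t * J^(beta-1)] of two minimizers. *)
Lemma minimizer_slope t u v l : 0 < t -> minimizer t u -> J v \is a fin_num ->
  convexity_gap (misfit alpha) (w u) (w v) 0 -> 0 < l < 1 ->
  misfit alpha (w u) - misfit alpha (w v) <=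
    t * (((1 - l) * j u + l * j v) `^ (beta - 1) * (j v - j u)).
Proof.
move=> t0 mu vfin gap /andP[l0 l1].
have l01 : 0 <= l <= 1 by rewrite !ltW.
have seg := minimizer_segment t0 mu vfin l01.
have {}gap := gap l; rewrite l0 l1 in gap; have {}gap := gap isT.
rewrite mulr0 addr0 in gap.
move: seg; set xi := _ + l * j v => seg.
have xi0 : 0 <= xi.
  by rewrite addr_ge0// mulr_ge0 ?fine_functional_ge0 ?(ltW l0)// subr_ge0 ltW.
have tg := powR_tangent beta1 xi0 (fine_functional_ge0 u).
have tg' : t / beta * (xi `^ beta - j u `^ beta) <=
   t / beta * (beta * (xi `^ (beta - 1) * (xi - j u))).
  by rewrite ler_wpM2l ?divr_ge0 ?(ltW t0) ?(ltW beta0).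
have E : t / beta * (beta * (xi `^ (beta - 1) * (xi - j u))) =
  l * (t * (xi `^ (beta - 1) * (j v - j u))).
  have -> : xi - j u = l * (j v - j u) by rewrite /xi; ring.
  by field; rewrite gt_eqF.
rewrite E in tg'; rewrite -(ler_pM2l l0); lra.
Qed.

End minimizers.

(** * Bounds along the solution path *)

Section solution_path.
Variables (R : realType) (X H : completeNormedModType R).
Variables (dot : {dot H for @idfun R}) (hH : induces_norm dot).
Variables (A : {linear X -> H}) (J : X -> \bar R).
Hypothesis J_ge0 : forall u, (0 <= J u)%E.
Hypothesis J_convex : convex_functional J.
Hypothesis J_hom : absolutely_one_homogeneous J.
Variable f : H.

Implicit Types (t s l : R) (u v : X).

Local Notation j u := (fine (J u)).
Local Notation w u := (A u - f).

Section least_residual.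
Variable beta : R.
Hypothesis beta1 : 1 < beta.

Local Notation minimizer t := (is_minimizer (energy A J f 1 beta t)).

Lemma convexity_gap0 (x y : H) : convexity_gap (misfit 1) x y 0.
Proof.
move=> l /andP[l0 l1]; rewrite /misfit invr1 !mul1r !powRr1// mulr0 addr0.
by apply: norm_comb_le; rewrite !ltW.
Qed.

(** Adding the slope inequalities at [t] and [s] shows that the effective
    parameter [t * J^(beta-1)] does not decrease along the path.  So [J^beta]
    decreases at most like [t^(-p)] with [p = beta / (beta - 1)], and Bernoulli's
    inequality linearizes this power. *)
Lemma functional_powB_le t s u v : 0 < s -> s < t ->
  minimizer t u -> minimizer s v ->
  j v `^ beta - j u `^ beta <= beta / (beta - 1) * j v `^ beta * ((t - s) / t).
Proof.
move=> s0 st mu mv; have t0 := lt_trans s0 st.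
have b0 : 0 < beta by exact: lt_trans beta1.
have b10 : 0 < beta - 1 by rewrite subr_gt0.
have ju := fine_functional_ge0 J_ge0 u; have jv := fine_functional_ge0 J_ge0 v.
have ts : 0 < t / s by rewrite divr_gt0.
have [jvu|juv] := leP (j v) (j u).
  apply: (@le_trans _ _ 0).
    by rewrite subr_le0 ge0_ler_powR// ?nnegrE// ltW.
  by rewrite !mulr_ge0 ?powR_ge0 ?invr_ge0 ?subr_ge0 ?ltW.
pose k := (beta - 1)^-1.
have k0 : 0 < k by rewrite invr_gt0.
have low : j v <= (t / s) `^ k * j u.
  rewrite -subr_le0.
  (* the limit [l -> 0] is taken after the root [k] has been extracted, when the
     inequality is affine in [l] *)
  rewrite -[leLHS](subrK ((j v - j u) * (1 + (t / s) `^ k))); apply: le_of_onem.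
  move=> l l01; move/andP : (l01) => [l0 l1].
  have S1 := minimizer_slope J_ge0 J_convex J_hom (ltW beta1) t0 mu
    (minimizer_fin_num J_ge0 J_hom (ltW beta1) s0 mv) (convexity_gap0 _ _) l01.
  have S2 := minimizer_slope J_ge0 J_convex J_hom (ltW beta1) s0 mv
    (minimizer_fin_num J_ge0 J_hom (ltW beta1) t0 mu) (convexity_gap0 _ _) l01.
  move: S1 S2; set xi := _ + l * j v; set xi' := _ + l * j u => S1 S2.
  have xi0 : 0 <= xi by rewrite addr_ge0// mulr_ge0 ?(ltW l0)// subr_ge0 ltW.
  have xi0' : 0 <= xi' by rewrite addr_ge0// mulr_ge0 ?(ltW l0)// subr_ge0 ltW.
  (* monotonicity of the effective parameter, at points between the two penalties *)
  have tau : s * xi' `^ (beta - 1) <= t * xi `^ (beta - 1).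
    have d0 : 0 < j v - j u by rewrite subr_gt0.
    rewrite -(ler_pM2r d0); lra.
  have : xi' <= (t / s) `^ k * xi.
    have e x : 0 <= x -> (x `^ (beta - 1)) `^ k = x.
      by move=> x0; rewrite -powRrM mulfV ?powRr1// gt_eqF.
    rewrite -(e xi')// -(e xi)// -powRM ?powR_ge0 ?(ltW ts)//.
    rewrite ge0_ler_powR ?nnegrE ?powR_ge0 ?(ltW k0)//.
      by rewrite mulr_ge0 ?powR_ge0 ?ltW.
    by rewrite mulrAC ler_pdivlMr// mulrC.
  rewrite /xi /xi'; set c := _ `^ k => h; nra.
pose p := beta / (beta - 1).
have p1 : 1 <= p by rewrite ler_pdivlMr// mul1r; lra.
have st0 : 0 < s / t by rewrite divr_gt0.
have low2 : (s / t) `^ p * j v `^ beta <= j u `^ beta.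
  have : j v `^ beta <= ((t / s) `^ k * j u) `^ beta.
    by rewrite ge0_ler_powR ?nnegrE ?(ltW b0) ?mulr_ge0 ?powR_ge0.
  rewrite powRM ?powR_ge0// -powRrM (mulrC k) -/p => h.
  have : (s / t) `^ p * j v `^ beta <= (s / t) `^ p * ((t / s) `^ p * j u `^ beta).
    by rewrite ler_wpM2l ?powR_ge0.
  rewrite mulrA -powRM ?(ltW st0) ?(ltW ts)//.
  rewrite (_ : s / t * (t / s) = 1); last by field; rewrite !gt_eqF.
  by rewrite powR1 mul1r.
have bern := powR_tangent p1 ler01 (ltW st0).
rewrite !powR1 mul1r in bern.
have bern' : (1 - (s / t) `^ p) * j v `^ beta <= p * (1 - s / t) * j v `^ beta.
  by rewrite ler_wpM2r// powR_ge0.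
have -> : p * j v `^ beta * ((t - s) / t) = p * (1 - s / t) * j v `^ beta.
  by field; rewrite gt_eqF.
lra.
Qed.

(** The squared increment splits into [(r t - r s)^2] and twice the
    Cauchy-Schwarz defect [c].  The sum of the two variational inequalities
    bounds [c] by a multiple of [(t - s) * (J (u s)^beta - J (u t)^beta)], hence
    of [(t - s)^2]; separately they bound the difference of the residuals. *)
Lemma path_increment_le_norm d t s u v : 0 < d -> d < s -> s < t ->
  minimizer t u -> minimizer s v ->
  `|A u - A v| <= `|f| * (beta / (d * (beta - 1)) + d^-1) * (t - s).
Proof.
move=> d0 ds st mu mv; have s0 := lt_trans d0 ds; have t0 := lt_trans s0 st.
have b0 : 0 < beta by exact: lt_trans beta1.
have b10 : 0 < beta - 1 by rewrite subr_gt0.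
have ufin := minimizer_fin_num J_ge0 J_hom (ltW beta1) t0 mu.
have vfin := minimizer_fin_num J_ge0 J_hom (ltW beta1) s0 mv.
have uM := minimizer_residual_le J_ge0 J_hom (lexx 1) (ltW beta1) t0 mu.
have vM := minimizer_residual_le J_ge0 J_hom (lexx 1) (ltW beta1) s0 mv.
have uv : w u - w v = A u - A v by rewrite opprB addrA subrK.
rewrite -uv; have [f0|fn0] := eqVneq `|f| 0.
  rewrite f0 in uM vM; have -> : w u = 0 by apply/normr0_eq0/le_anti; rewrite uM normr_ge0.
  have -> : w v = 0 by apply/normr0_eq0/le_anti; rewrite vM normr_ge0.
  by rewrite subrr normr0 f0 !mul0r.
have {fn0} M0 : 0 < `|f| by rewrite lt_neqAle eq_sym fn0 normr_ge0.
have G1 := minimizer_gap J_ge0 J_convex J_hom (ltW beta1) t0 mu vfin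
  (convexity_gap_norm hH M0 uM vM).
have G2 := minimizer_gap J_ge0 J_convex J_hom (ltW beta1) s0 mv ufin
  (convexity_gap_norm hH M0 vM uM).
have Y := functional_powB_le s0 st mu mv.
have Ys := minimizer_functional_le J_ge0 J_hom (lexx 1) (ltW beta1) s0 mv.
have D2 := normB2 hH (w u) (w v).
rewrite (mulrC `|w v|) (dotC dot (w v)) in G2.
have c0 : 0 <= `|w u| * `|w v| - dot (w u) (w v) by rewrite subr_ge0 (dot_le hH).
move: G1 G2 Y Ys c0 D2 uM vM; rewrite /misfit invr1 !mul1r !powRr1//.
move: (dot _ _) (`|w u - w v|) (normr_ge0 (w u - w v)) => pq D D0.
move: (`|w u|) (`|w v|) `|f| M0 (normr_ge0 (w u)) (normr_ge0 (w v)).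
move: (j u `^ beta) (j v `^ beta) (powR_ge0 (j u) beta) (powR_ge0 (j v) beta).
move=> yt ys yt0 ys0 a b M M0 a0 b0' G1 G2 Y Ys c0 D2 uM vM.
set c := a * b - pq in G1 G2 c0.
have cM0 : 0 <= c / M by rewrite divr_ge0// ltW.
pose B := beta * M / (d * (beta - 1)).
have ysM : ys <= beta * M / d.
  rewrite ler_pdivlMr// mulrC.
  have : s * ys <= beta * M by move: Ys; rewrite mulrAC ler_pdivrMr// (mulrC M).
  by apply: le_trans; rewrite ler_wpM2r// ltW.
have ts0 : 0 < t - s by rewrite subr_gt0.
have sum : 2 * (c / M) <= (t - s) / beta * (ys - yt).
  have -> : (t - s) / beta = t / beta - s / beta by rewrite mulrBl.
  by lra.
have yts : 0 <= ys - yt.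
  have : 0 <= (t - s) / beta * (ys - yt) by apply: le_trans sum; rewrite mulr_ge0.
  by rewrite pmulr_rge0// divr_gt0.
have tY : t / beta * (ys - yt) <= B * (t - s).
  have : t / beta * (ys - yt) <= t / beta * (beta / (beta - 1) * ys * ((t - s) / t)).
    by rewrite ler_wpM2l// ltW// divr_gt0.
  have -> : t / beta * (beta / (beta - 1) * ys * ((t - s) / t)) =
     ys * ((t - s) / (beta - 1)) by field; rewrite !gt_eqF.
  move=> /le_trans; apply.
  have -> : B * (t - s) = beta * M / d * ((t - s) / (beta - 1)).
    by rewrite /B; field; rewrite !gt_eqF.
  by rewrite ler_wpM2r// ltW// divr_gt0.
have rad1 : a - b <= B * (t - s) by lra.
(* the residual does not decrease along the path *)
have rad2 : b - a <= 0.
  have : 0 <= s / beta * (ys - yt) by rewrite mulr_ge0// ltW// divr_gt0.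
  lra.
have ang : 2 * c <= M / d * B * (t - s) ^+ 2.
  have : t * (2 * (c / M)) <= (t - s) * (t / beta * (ys - yt)).
    have -> : (t - s) * (t / beta * (ys - yt)) = t * ((t - s) / beta * (ys - yt)).
      by ring.
    by rewrite ler_pM2l.
  have h2 : (t - s) * (t / beta * (ys - yt)) <= (t - s) * (B * (t - s)).
    by rewrite ler_pM2l.
  have h3 : d * (2 * (c / M)) <= t * (2 * (c / M)).
    by apply: ler_wpM2r; [rewrite mulr_ge0|exact: ltW (lt_trans ds st)].
  move=> h1.
  have -> : 2 * c = (d * (2 * (c / M))) * (M / d) by field; rewrite !gt_eqF.
  have -> : M / d * B * (t - s) ^+ 2 = (t - s) * (B * (t - s)) * (M / d) by ring.
  rewrite ler_wpM2r ?divr_ge0 ?(ltW M0) ?(ltW d0)//; lra.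
have B0 : 0 <= B.
  by rewrite /B divr_ge0 ?mulr_ge0 ?(ltW M0) ?(ltW b0) ?(ltW d0) ?(ltW b10).
have Md0 : 0 <= M / d by rewrite divr_ge0 ?(ltW M0) ?(ltW d0).
have -> : M * (beta / (d * (beta - 1)) + d^-1) = B + M / d.
  by rewrite /B; field; rewrite !gt_eqF.
have N0 : 0 <= (B + M / d) * (t - s) by rewrite mulr_ge0 ?(ltW ts0)// addr_ge0.
rewrite -(@ler_pXn2r _ 2%N) ?nnegrE//.
(* radial and angular parts of the increment *)
have -> : D ^+ 2 = (a - b) ^+ 2 + 2 * c by rewrite D2 /c; ring.
have : (a - b) ^+ 2 <= (B * (t - s)) ^+ 2 by rewrite lerXn2r ?nnegrE//; lra.
have : 0 <= (B * (M / d) + (M / d) ^+ 2) * (t - s) ^+ 2.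
  apply: mulr_ge0; last exact: exprn_ge0 (ltW ts0).
  by apply: addr_ge0; [exact: mulr_ge0|exact: exprn_ge0].
lra.
Qed.

End least_residual.

Section one_homogeneous_penalty.
Variable alpha : R.
Hypothesis alpha12 : 1 < alpha < 2.

Local Notation minimizer t := (is_minimizer (energy A J f alpha 1 t)).

Let alpha1 : 1 < alpha. Proof. by case/andP: alpha12. Qed.
Let alpha0 : 0 < alpha. Proof. exact: lt_trans alpha1. Qed.

(** On the segment from [u] to an exact solution the residual shrinks by the
    factor [1 - l], so the misfit loses [r^alpha] to first order in [l]. *)
Lemma residual_pow_le t u v : 0 < t -> minimizer t u -> A v = f ->
  J v \is a fin_num -> `|w u| `^ alpha <= t * (j v - j u).
Proof.
move=> t0 mu Avf vfin; rewrite -[leLHS]add0r; apply: le_of_onem => l /andP[l0 l1].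
have l01 : 0 <= l <= 1 by rewrite !ltW.
have := minimizer_segment J_ge0 J_convex J_hom (lexx 1) t0 mu vfin l01.
rewrite Avf subrr scaler0 addr0 /misfit normrZ ger0_norm ?subr_ge0 ?(ltW l1)//.
rewrite invr1 mulr1 !powRr1 ?fine_functional_ge0//; last first.
  by rewrite addr_ge0// mulr_ge0 ?fine_functional_ge0 ?(ltW l0)// subr_ge0 ltW.
rewrite powRM ?subr_ge0 ?(ltW l1)//.
have := @powR_tangent _ alpha (1 - l) 1 (ltW alpha1).
rewrite subr_ge0 (ltW l1) ler01 => /(_ isT isT); rewrite powR1.
have pl : 1 - l <= (1 - l) `^ (alpha - 1).
  by apply: ger1_powR; case/andP: alpha12 => _ ?; lra.
move: pl; set P := _ `^ (alpha - 1); set Q := _ `^ alpha; set W := _ `^ alpha.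
move=> pl tg seg.
have W0 : 0 <= alpha^-1 * W by rewrite mulr_ge0 ?powR_ge0 ?invr_ge0 ?(ltW alpha0).
have tg' : (alpha^-1 * W) * (Q - 1) <= (alpha^-1 * W) * (alpha * (P * (1 - l - 1))).
  by rewrite ler_wpM2l.
have E : (alpha^-1 * W) * (alpha * (P * (1 - l - 1))) = - (l * (P * W)).
  by field; rewrite gt_eqF.
have PW : (1 - l) * W <= P * W by rewrite ler_wpM2r ?powR_ge0.
have lPW : l * (P * W) <= l * (t * (j v - j u)) by rewrite E in tg'; lra.
by rewrite add0r; rewrite ler_pM2l// in lPW; exact: le_trans PW lPW.
Qed.

Lemma residual_pow_le_Jmin t u : 0 < t -> minimizer t u -> range_condition A J f ->
  `|w u| `^ alpha <= t * Jmin A J f.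
Proof.
move=> t0 mu [v0 v0dom Av0].
rewrite -ler_pdivrMl//.
set S := [set J v | v in [set v | A v = f]].
have lb v : A v = f -> ((t^-1 * `|w u| `^ alpha)%:E <= J v)%E.
  move=> Av; have [vy|vy] := eqVneq (J v) +oo%E; first by rewrite vy leey.
  have vfin : J v \is a fin_num by rewrite ge0_fin_numE// lt_neqAle vy leey.
  rewrite -(fineK vfin) lee_fin ler_pdivrMl//.
  apply: le_trans (residual_pow_le t0 mu Av vfin) _.
  by rewrite ler_wpM2l ?(ltW t0)// gerBl fine_functional_ge0.
have ge : ((t^-1 * `|w u| `^ alpha)%:E <= ereal_inf S)%E.
  by apply: le_ereal_inf_tmp => _ [v Av <-]; exact: lb.
rewrite /Jmin -/S -lee_fin fineK// fin_numE.
apply/andP; split.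
  by apply/eqP => E; rewrite E in ge; have := lt_le_trans (ltNyr _) ge; rewrite ltxx.
apply/eqP => E; have : (ereal_inf S <= J v0)%E by apply: ereal_inf_lbound; exists v0.
by rewrite E leye_eq => /eqP E0; move: v0dom; rewrite /dom/= E0 ltxx.
Qed.

(** The subgradient inequality turns the gain [J v - J u] in [residual_pow_le]
    into [|q| * r], and one power of [r] cancels. *)
Lemma residual_pow_le_source t u v (q : H) : 0 < t -> minimizer t u -> A v = f ->
  dom J v -> subdiff J v (adjoint dot A q) ->
  `|w u| `^ (alpha - 1) <= t * `|q|.
Proof.
move=> t0 mu Av vdom [_ _ sub].
have vfin : J v \is a fin_num by rewrite ge0_fin_numE.
have ufin := minimizer_fin_num J_ge0 J_hom (lexx 1) t0 mu.
have := residual_pow_le t0 mu Av vfin.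
have := sub u; rewrite /adjoint linearB/= Av -(fineK ufin) -(fineK vfin) -EFinD lee_fin.
move=> sd rp.
have qw : - dot q (w u) <= `|q| * `|w u|.
  by have := dot_le hH q (- w u); rewrite linearN/= normrN.
have {rp} rp : `|w u| `^ alpha <= `|w u| * (t * `|q|).
  apply: (le_trans rp); rewrite mulrCA ler_pM2l// mulrC; lra.
have [->|wn0] := eqVneq `|w u| 0.
  by rewrite powR0 ?mulr_ge0 ?(ltW t0)// gt_eqF// subr_gt0.
have w0 : 0 < `|w u| by rewrite lt_neqAle eq_sym wn0 normr_ge0.
by rewrite -(mulr_powRB1 _ alpha0)// ler_pM2l in rp.
Qed.

Lemma residual_pow_le_sstar t u : 0 < t -> minimizer t u ->
  source_condition dot A J f -> `|w u| `^ (alpha - 1) <= t * sstar dot A J f.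
Proof.
move=> t0 mu [v [vd Av [q hq]]]; rewrite -ler_pdivrMl//; apply: lb_le_inf.
  by exists `|q|, q => //; exists v.
move=> _ [p [z [zd Az hp]] <-]; rewrite ler_pdivrMl//.
exact: residual_pow_le_source hp.
Qed.

End one_homogeneous_penalty.

End solution_path.

(** * Lipschitz continuity and derivative of the path *)

Section assembly.
Variables (R : realType) (X H : completeNormedModType R).
Variables (dot : {dot H for @idfun R}) (hH : induces_norm dot).
Variables (A : {linear X -> H}) (J : X -> \bar R).
Hypothesis J_ge0 : forall u, (0 <= J u)%E.
Hypothesis J_convex : convex_functional J.
Hypothesis J_hom : absolutely_one_homogeneous J.
Variables (f : H) (alpha beta : R).
Hypothesis halpha : 1 <= alpha < 2.
Hypothesis hbeta : 1 <= beta.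
Hypothesis halphabeta : 1 < alpha \/ 1 < beta.
Variable u : R -> X.
Hypothesis hu : forall t : R, 0 < t -> is_minimizer (energy A J f alpha beta t) (u t).

Let alpha1 : 1 <= alpha. Proof. by case/andP: halpha. Qed.

(** For [alpha = 1] the residual is controlled through [J], for [alpha > 1] by the
    strong convexity of the misfit on the ball of radius [|f| + 1]; the added
    [1] only serves to make the radius positive. *)
Lemma path_lipschitz d : 0 < d -> exists2 L : R, 0 <= L & forall s t : R,
  d < s -> d < t -> `|A (u t) - A (u s)| <= L * `|t - s|.
Proof.
move=> d0; move: alpha1; rewrite le_eqVlt => /predU1P[a1|a1].
  have b1 : 1 < beta by case: halphabeta => //; rewrite -a1 ltxx.
  move: hu; rewrite -a1 => hu1.
  exists (`|f| * (beta / (d * (beta - 1)) + d^-1)).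
    apply: mulr_ge0 => //; apply: addr_ge0; last by rewrite invr_ge0 ltW.
    apply: divr_ge0; first exact: le_trans hbeta.
    by rewrite mulr_ge0 ?subr_ge0 ?(ltW d0).
  have main s t : d < s -> s < t ->
      `|A (u t) - A (u s)| <= `|f| * (beta / (d * (beta - 1)) + d^-1) * (t - s).
    move=> ds st; apply: (path_increment_le_norm hH J_ge0 J_convex J_hom b1) => //.
      by apply: hu1; apply: lt_trans st; exact: lt_trans ds.
    by apply: hu1; exact: lt_trans ds.
  move=> s t ds dt; have [st|ts|->] := ltgtP s t.
  - by rewrite [in leRHS]gtr0_norm ?subr_gt0//; exact: main.
  - by rewrite distrC [in leRHS]distrC [in leRHS]gtr0_norm ?subr_gt0//; exact: main.
  - by rewrite !subrr !normr0 mulr0.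
have a12 : 1 < alpha < 2 by rewrite a1; case/andP: halpha.
have M0 : 0 < `|f| + 1 by rewrite ltr_wpDl.
have c0 : 0 < (alpha - 1) * d by rewrite mulr_gt0// subr_gt0.
exists ((`|f| + 1) / ((alpha - 1) * d)); first by rewrite divr_ge0 ?(ltW M0) ?(ltW c0).
move=> s t ds dt; have s0 := lt_trans d0 ds; have t0 := lt_trans d0 dt.
have res r : 0 < r -> `|A (u r) - f| <= `|f| + 1.
  move=> r0; rewrite (le_trans (minimizer_residual_le J_ge0 J_hom alpha1 hbeta r0 (hu r0)))//.
  by rewrite lerDl.
have h := path_increment_le hH J_ge0 J_convex J_hom alpha1 hbeta a12 t0 s0
  (hu t0) (hu s0) M0 (res t t0) (res s s0).
rewrite [leRHS]mulrAC ler_pdivlMr//.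
have : `|A (u t) - A (u s)| * ((alpha - 1) * (2 * d)) <=
   `|A (u t) - A (u s)| * ((alpha - 1) * (t + s)).
  by rewrite ler_wpM2l// ler_wpM2l ?subr_ge0//; lra.
lra.
Qed.

Lemma path_ae_derivable :
  {ae @lebesgue_measure R, forall t : R, 0 < t -> derivable ((A \o u) : R^o -> H) t 1}.
Proof. exact: (locally_lipschitz_ae_derivable hH path_lipschitz). Qed.

(** [path_increment_le] is applied at [t] and [t + h] with a radius [M] that tends
    to the residual at [t] as [h] tends to [0], so that the
    residual at [t], and not just its upper bound [|f|], appears in the limit. *)
Lemma path_derivative_le t : 1 < alpha -> 0 < t ->
  derivable ((A \o u) : R^o -> H) t 1 ->
  `|derive1 ((A \o u) : R^o -> H) t| <= (alpha - 1)^-1 * (`|A (u t) - f| / t).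
Proof.
move=> a1 t0 dt; apply: norm_derive1_le => // e e0.
have a12 : 1 < alpha < 2 by rewrite a1; case/andP: halpha.
have a10 : 0 < alpha - 1 by rewrite subr_gt0.
have [L L0 hL] := path_lipschitz (divr_gt0 t0 (ltr0n R 2)).
set r := `|_ - f|; have r0 : 0 <= r by exact: normr_ge0.
pose e' := (alpha - 1) * e; have e'0 : 0 < e' by rewrite mulr_gt0.
pose K := 2 * (L + 1) + r / t + e'.
have rt0 : 0 <= r / t by rewrite divr_ge0// ltW.
have K0 : 0 < K by rewrite /K; lra.
(* for these [h] one has [2 * M <= (r / t + e') * (2 * t - |h|)], and
   [2 * t - |h|] is a lower bound for the sum [(t + h) + t] *)
exists (Num.min (t / 2) (2 * t * e' / K)).
  by rewrite lt_min !divr_gt0// !mulr_gt0.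
move=> h /andP[h0]; rewrite lt_min => /andP[ht hK].
have th2 : t / 2 < t + h by have := ler_norm (- h); rewrite normrN; lra.
have th0 : 0 < t + h by apply: lt_trans th2; rewrite divr_gt0.
have inc := hL t (t + h); rewrite th2 in inc.
have {}inc : `|A (u (t + h)) - A (u t)| <= L * `|h|.
  by have -> : `|h| = `|t + h - t|; [rewrite addrC addKr|apply: inc => //; lra].
pose M := r + (L + 1) * `|h|.
have M0 : 0 < M by rewrite /M ltr_wpDl// mulr_gt0// ltr_wpDl.
have rM : r <= M by rewrite /M lerDl mulr_ge0// addr_ge0.
have rhM : `|A (u (t + h)) - f| <= M.
  have -> : A (u (t + h)) - f = (A (u (t + h)) - A (u t)) + (A (u t) - f).
    by rewrite addrA subrK.
  rewrite (le_trans (ler_normD _ _))// -/r /M; lra.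
have := path_increment_le hH J_ge0 J_convex J_hom alpha1 hbeta a12 th0 t0
  (hu th0) (hu t0) M0 rhM rM.
rewrite [t + h - t]addrC addKr /=.
set D := `|_ - _| => hD.
have D0 : 0 <= D by exact: normr_ge0.
have hh := ler_norm (- h); rewrite normrN in hh.
have low : D * ((alpha - 1) * (2 * t - `|h|)) <= 2 * M * `|h|.
  apply: le_trans hD; rewrite ler_wpM2l// ler_wpM2l ?(ltW a10)//; lra.
have q0 : 0 < (alpha - 1) * (2 * t - `|h|) by rewrite mulr_gt0//; lra.
rewrite -(ler_pM2r q0); apply: le_trans low _.
have Kh : K * `|h| <= 2 * t * e' by rewrite mulrC -ler_pdivlMr// ltW.
have -> : ((alpha - 1)^-1 * (r / t) + e) * `|h| * ((alpha - 1) * (2 * t - `|h|)) =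
   (2 * r + 2 * t * e' - (r / t + e') * `|h|) * `|h|.
  by rewrite /e'; field; rewrite !gt_eqF.
rewrite ler_pM2r// /M; rewrite /K in Kh; lra.
Qed.

End assembly.

Lemma root_div_le (R : realType) (p r c t : R) : 0 < p -> 0 <= r -> 0 < t ->
  r `^ p <= t * c -> r / t <= c `^ p^-1 * t `^ (p^-1 - 1).
Proof.
move=> p0 r0 t0 h.
have c0 : 0 <= c by rewrite -(pmulr_rge0 _ t0) (le_trans _ h)// powR_ge0.
have -> : c `^ p^-1 * t `^ (p^-1 - 1) = (t * c) `^ p^-1 / t.
  rewrite powRM ?(ltW t0)// powRB ?(gt_eqF t0) ?implybT// powRr1 ?(ltW t0)//.
  by rewrite mulrCA mulrA.
rewrite ler_pM2r ?invr_gt0//.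
have -> : r = (r `^ p) `^ p^-1 by rewrite -powRrM mulfV ?gt_eqF// powRr1.
by rewrite ge0_ler_powR ?nnegrE ?powR_ge0 ?invr_ge0 ?(ltW p0)// mulr_ge0// ltW.
Qed.

Theorem theorem3p8 (R : realType)
  (Y : completeNormedModType R) (hY : separable Y)
  (X : completeNormedModType R)
  (b : {bilinear X -> Y -> R | *%R & *%R}) (hX : is_dual_of b)
  (H : completeNormedModType R)
  (dot : {dot H for @idfun R}) (hH : induces_norm dot)
  (A : {linear X -> H}) (hA : bounded_operator A)
  (J : X -> \bar R) (J_ge0 : forall u : X, (0 <= J u)%E)
  (J_convex : convex_functional J) (J_proper : proper_functional J)
  (J_lsc : weak_star_lsc b J) (J_hom : absolutely_one_homogeneous J)
  (f : H) (hf : forall u : X, A u = f -> J u <> 0%E)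
  (hnorm : norm_equiv_on_null_set A J)
  (hpoincare : poincare_inequality A J)
  (hweak : forall (v : nat -> X) (x : X),
     weak_star_cvg b v x -> weak_cvg dot (fun n => A (v n)) (A x))
  (alpha beta : R) (halpha : 1 <= alpha < 2) (hbeta : 1 <= beta)
  (halphabeta : 1 < alpha \/ 1 < beta)
  (u : R -> X)
  (hu : forall t : R, 0 < t -> is_minimizer (energy A J f alpha beta t) (u t)) :
  let g : R^o -> H := fun t => A (u t) in
  let r : R -> R := fun t => `|g t - f| in
  let mu := @lebesgue_measure R in
  [/\ (* Lipschitz continuity and a.e. differentiability *)
      forall delta : R, 0 < delta ->
        [lipschitz g t | t in `]delta, +oo[%classic] /\
        {ae mu, forall t : R, delta < t -> derivable g t 1},
      (* general bound *)
      1 < alpha -> beta = 1 ->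
        {ae mu, forall t : R, 0 < t ->
          `|derive1 g t| <= (alpha - 1)^-1 * (r t / t) /\
          (alpha - 1)^-1 * (r t / t) <= (alpha - 1)^-1 * (`|f| / t)},
      (* improvement under the range condition *)
      1 < alpha -> beta = 1 -> range_condition A J f ->
        {ae mu, forall t : R, 0 < t ->
          `|derive1 g t| <=
            (alpha - 1)^-1 * C_R A J f alpha beta * t `^ ((1 - alpha) / alpha)}
    & (* improvement under the range and source conditions *)
      1 < alpha -> beta = 1 -> range_condition A J f ->
      source_condition dot A J f ->
        {ae mu, forall t : R, 0 < t ->
          `|derive1 g t| <=
            (alpha - 1)^-1 * C_S dot A J f alpha beta
              * t `^ ((2 - alpha) / (alpha - 1))}].

Proof.
move=> g r mu.
have lip := path_lipschitz hH J_ge0 J_convex J_hom halpha hbeta halphabeta hu.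
have der := path_ae_derivable hH J_ge0 J_convex J_hom halpha hbeta halphabeta hu.
have bound := path_derivative_le hH J_ge0 J_convex J_hom halpha hbeta halphabeta hu.
split.
- move=> d d0; split; last by apply: ae_imply der => t dt /(lt_trans d0); exact: dt.
  have [L _ hL] := lip d d0; apply: (@klipschitzW _ _ _ L).
    apply: (@globally_properfilter _ _ (d + 1, d + 1)).
    by split; rewrite /= in_itv/= andbT ltrDl.
  move=> [x y] [] /=; rewrite !in_itv/= !andbT => dx dy; exact: hL.
- move=> a1 b1; apply: ae_imply der => t dt t0; split; first exact: bound (dt t0).
  rewrite ler_pM2l ?invr_gt0 ?subr_gt0// ler_pM2r ?invr_gt0//.
  exact: (minimizer_residual_le J_ge0 J_hom (ltW a1) hbeta t0 (hu t t0)).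
- move=> a1 b1 rc; apply: ae_imply der => t dt t0.
  apply: (le_trans (bound t a1 t0 (dt t0))); rewrite -mulrA ler_pM2l ?invr_gt0 ?subr_gt0//.
  have a12 : 1 < alpha < 2 by rewrite a1; case/andP: halpha.
  have a0 : 0 < alpha by lra.
  have := hu t t0; rewrite b1 => mt.
  have := residual_pow_le_Jmin J_ge0 J_convex J_hom a12 t0 mt rc.
  move=> /(root_div_le a0 (normr_ge0 _) t0); rewrite /C_R div1r.
  by rewrite (_ : alpha^-1 - 1 = (1 - alpha) / alpha)//; field; rewrite gt_eqF.
- move=> a1 b1 rc sc; apply: ae_imply der => t dt t0.
  apply: (le_trans (bound t a1 t0 (dt t0))); rewrite -mulrA ler_pM2l ?invr_gt0 ?subr_gt0//.
  have a12 : 1 < alpha < 2 by rewrite a1; case/andP: halpha.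
  have a10 : 0 < alpha - 1 by rewrite subr_gt0.
  have := hu t t0; rewrite b1 => mt.
  have := residual_pow_le_sstar hH J_ge0 J_convex J_hom a12 t0 mt sc.
  move=> /(root_div_le a10 (normr_ge0 _) t0).
  rewrite /C_S subrr mul0r powRr0 mulr1.
  by rewrite (_ : (alpha - 1)^-1 - 1 = (2 - alpha) / (alpha - 1))//; field; rewrite gt_eqF.
Qed.
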